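(* Let $p,s,r$ be integers with $1\le r\le s\le p$, let $n\in\mathbb{N}$, $\lambda>0$, and let $\mathbf{X}$ be generated by the spiked model with $\sigma=1$. There is an absolute constant $c>0$ such that \[ \inf_{\widehat{\mathbf{V}}}\ \sup_{\boldsymbol{\Sigma}\in\Theta_0(s,p,r,\lambda)} \mathsf{E}\bigl\|\widehat{\mathbf{V}}\widehat{\mathbf{V}}'-\mathbf{V}\mathbf{V}'\bigr\|_{\mathrm F}^2\ \ge\ c\left(\left[\frac{1}{nh(\lambda)}\Bigl(r(s-r)+(s-r)\log\frac{\mathrm{e}(p-r)}{s-r}\Bigr)\right]\wedge 1\right), \] where the infimum is over all estimators $\widehat{\mathbf{V}}$ (measurable functions of $\mathbf{X}$ with values in $O(p,r)$), and the term $(s-r)\log\frac{\mathrm{e}(p-r)}{s-r}$ is interpreted as $0$ when $s=r$.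
   Context: Spiked model: $\mathbf{X}=\mathbf{U}\mathbf{D}\mathbf{V}'+\mathbf{Z}$ is $n\times p$, where $\mathbf{U}$ is $n\times r$ with i.i.d. $N(0,1)$ entries, $\mathbf{D}=\operatorname{diag}(\lambda_1^{1/2},\dots,\lambda_r^{1/2})$, $\mathbf{V}\in O(p,r)=\{\mathbf{V}\in\mathbb{R}^{p\times r}:\mathbf{V}'\mathbf{V}=\mathbf{I}_r\}$, and $\mathbf{Z}$ has i.i.d. $N(0,\sigma^2)$ entries independent of $\mathbf{U}$; equivalently the rows of $\mathbf{X}$ are i.i.d. $N(0,\boldsymbol{\Sigma})$ with $\boldsymbol{\Sigma}=\mathbf{V}\boldsymbol{\Lambda}\mathbf{V}'+\sigma^2\mathbf{I}_p$, $\boldsymbol{\Lambda}=\operatorname{diag}(\lambda_1,\dots,\lambda_r)$. Fix a constant $\kappa>1$. Parameter space: $\Theta_0(s,p,r,\lambda)=\{\boldsymbol{\Sigma}=\mathbf{V}\boldsymbol{\Lambda}\mathbf{V}'+\mathbf{I}_p: 0<\lambda\le\lambda_r\le\dots\le\lambda_1\le\kappa\lambda,\ \mathbf{V}\in O(p,r),\ \mathbf{V}\text{ has at most } s \text{ nonzero rows}\}$. $h(\lambda)=\lambda^2/(\lambda+1)$. *)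

(* Defs.v *)
From HB Require Import structures.
From mathcomp Require Import all_boot all_order all_algebra.
From mathcomp Require Import all_classical all_reals all_analysis.
From mathcomp Require Import normal_distribution.
Set Implicit Arguments. Unset Strict Implicit. Unset Printing Implicit Defensive.
Import Order.TTheory GRing.Theory Num.Theory.
Local Open Scope classical_set_scope.
Local Open Scope ring_scope.

Section SpikedModel.
Variable R : realType.

Definition frob2 (m k : nat) (A : 'M[R]_(m, k)) : R :=
  \sum_(i < m) \sum_(j < k) (A i j) ^+ 2.

Definition orth_frame (p r : nat) (V : 'M[R]_(p, r)) : Prop := V^T *m V = 1%:M.

Definition nnz_rows (p r : nat) (V : 'M[R]_(p, r)) : nat :=
  #|[set i : 'I_p | row i V != 0]|.

(* Parameter space Theta_0(s,p,r,lambda) (with sigma = 1), parametrised by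
   (V, Lambda) with Sigma = V Lambda V' + I_p. *)
Definition Theta0 (kappa : R) (s p r : nat) (lambda : R)
    (V : 'M[R]_(p, r)) (lam : 'I_r -> R) : Prop :=
  [/\ orth_frame V, (nnz_rows V <= s)%N,
      (forall i, lambda <= lam i /\ lam i <= kappa * lambda) &
      (forall i j : 'I_r, (i <= j)%N -> lam j <= lam i)].

Definition Dmat (r : nat) (lam : 'I_r -> R) : 'M[R]_r :=
  diag_mx (\row_i Num.sqrt (lam i)).

Definition spiked (n p r : nat) (U : 'M[R]_(n, r)) (Z : 'M[R]_(n, p))
    (V : 'M[R]_(p, r)) (lam : 'I_r -> R) : 'M[R]_(n, p) :=
  U *m Dmat lam *m V^T + Z.

Definition mx_coord_sets (n p : nat) : set (set 'M[R]_(n, p)) :=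
  [set A | exists (i : 'I_n) (j : 'I_p) (B : set R),
     measurable B /\ A = (fun X : 'M[R]_(n, p) => X i j) @^-1` B].

Definition mx_borel_measurable (n p k l : nat) (f : 'M[R]_(n, p) -> 'M[R]_(k, l))
  : Prop :=
  forall (a : 'I_k) (b : 'I_l) (B : set R), measurable B ->
    <<s @mx_coord_sets n p >> ((fun X => f X a b) @^-1` B).

Definition estimator (n p r : nat) (Vhat : 'M[R]_(n, p) -> 'M[R]_(p, r)) : Prop :=
  mx_borel_measurable Vhat /\ forall X, orth_frame (Vhat X).

(* U (n x r) and Z (n x p) have jointly i.i.d. N(0,1) entries on the
   probability space (T, P): all n*r + n*p entries are measurable and
   mutually independent, each with law N(0,1). *)
Definition gauss_entries (d : measure_display) (T : measurableType d)
    (P : probability T R) (n p r : nat)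
    (U : T -> 'M[R]_(n, r)) (Z : T -> 'M[R]_(n, p)) : Prop :=
  let g (k : ('I_n * 'I_r) + ('I_n * 'I_p)) : T -> R :=
    match k with inl ij => fun t => U t ij.1 ij.2
               | inr ij => fun t => Z t ij.1 ij.2 end in
  (forall k, measurable_fun setT (g k)) /\
  forall B : ('I_n * 'I_r) + ('I_n * 'I_p) -> set R,
    (forall k, measurable (B k)) ->
    P (\bigcap_(k in [set: ('I_n * 'I_r) + ('I_n * 'I_p)]) (g k @^-1` B k))
    = (\prod_(k : ('I_n * 'I_r) + ('I_n * 'I_p)) normal_prob 0 1 (B k))%E.

Definition risk (d : measure_display) (T : measurableType d)
    (P : probability T R) (n p r : nat)
    (U : T -> 'M[R]_(n, r)) (Z : T -> 'M[R]_(n, p))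
    (Vhat : 'M[R]_(n, p) -> 'M[R]_(p, r)) (V : 'M[R]_(p, r)) (lam : 'I_r -> R)
  : \bar R :=
  (\int[P]_t (frob2 (Vhat (spiked (U t) (Z t) V lam) *m
                       (Vhat (spiked (U t) (Z t) V lam))^T - V *m V^T))%:E)%E.

Definition minimax_risk (kappa : R) (s : nat) (lambda : R)
    (d : measure_display) (T : measurableType d)
    (P : probability T R) (n p r : nat)
    (U : T -> 'M[R]_(n, r)) (Z : T -> 'M[R]_(n, p)) : \bar R :=
  ereal_inf [set ereal_sup
                 [set x | exists (V : 'M[R]_(p, r)) (lam : 'I_r -> R),
                    Theta0 kappa s lambda V lam /\ x = risk P U Z Vhat V lam]
            | Vhat in [set Vhat | @estimator n p r Vhat]].

Definition hfun (x : R) : R := x ^+ 2 / (x + 1).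

Definition sparse_term (p s r : nat) : R :=
  if s == r then 0
  else (s - r)%:R * ln (expR 1 * (p - r)%:R / (s - r)%:R).

Definition rate (n p s r : nat) (lambda : R) : R :=
  Num.min (((r * (s - r))%:R + sparse_term p s r) / (n%:R * hfun lambda)) 1.

End SpikedModel.

(* Main.v *)
Require Import Defs.
From HB Require Import structures.
From mathcomp Require Import all_boot all_order all_algebra.
From mathcomp Require Import all_classical all_reals all_analysis.
From mathcomp Require Import measure measurable_realfun lebesgue_measure.
From mathcomp Require Import normal_distribution.
From mathcomp Require Import ring lra.
Set Implicit Arguments. Unset Strict Implicit. Unset Printing Implicit Defensive.
Import Order.TTheory GRing.Theory Num.Theory.
Import numFieldNormedType.Exports.
Local Open Scope classical_set_scope.
Local Open Scope ring_scope.

(** A lower bound over a finite product family of covariances, all with equal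
    spikes [lambda].  For a [q x r] matrix [W] the frame [V] spans the column space
    of [[I; eps W]]; as long as [eps^2 |W|^2 <= 1], the distance between two such
    projections is comparable to [eps |W - W'|].  The matrices [W] are indexed by
    words [theta] in [{0,..,M+1}^B], each letter switching on at most one entry, so
    that the loss dominates the Hamming distance of the words.

    Estimating one letter is an (M+2)-ary testing problem.  For any event [A] and
    [t >= 0], the variational bound
      [t P_V(A) <= KL(P_V, P_V') + (e^t - 1) P_V'(A)]
    with [KL <= C n h(lambda) (r - |V' V|^2)], averaged over the replacement of a
    single letter, bounds the probability of decoding it correctly away from 1 when
    [n h(lambda) eps^2] is at most a small multiple of [log (M+2)].  Taking [B] to
    be the [(s-r) x r] entries with a binary alphabet gives the term [r (s-r)]; taking
    [s-r] blocks of [floor ((p-r) / (s-r))] coordinates gives the logarithmic term.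

    The law of [X] is compared under [V] and [V'] without determinants: the linear
    map carrying one model to the other is a product of three block shears of the
    Gaussian entries [(U, Z)], and shears preserve the measure
    [e^(|w|^2 / 2) dP(w)], a multiple of Lebesgue measure. *)

(** * Finite-dimensional coordinate space and uniqueness of measures on it *)

Definition vec (R : realType) (K : finType) : Type := K -> R.
HB.instance Definition _ R K := gen_eqMixin (vec R K).
HB.instance Definition _ R K := gen_choiceMixin (vec R K).
HB.instance Definition _ R K := isPointed.Build (vec R K) (fun=> 0).

Definition coord_sets (R : realType) (K : finType) : set (set (vec R K)) :=
  [set A | exists (k : K) (B : set R),
     measurable B /\ A = (fun w : vec R K => w k) @^-1` B].
Notation Om R K := (g_sigma_algebraType (@coord_sets R K)).

Section CoordinateSpace.
Variables (R : realType) (K : finType).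

Lemma measurable_coord (k : K) : measurable_fun setT (fun w : Om R K => w k : R).
Proof.
move=> _ B mB; rewrite setTI; apply: sub_sigma_algebra.
by exists k, B.
Qed.

Lemma measurable_to_Om d (T : measurableType d) (f : T -> Om R K) :
  (forall k, measurable_fun setT (fun t => f t k)) -> measurable_fun setT f.
Proof.
move=> mf; apply: (@measurability _ _ T (Om R K) setT f (@coord_sets R K)) => //.
move=> _ [_ [k [B [mB ->]]] <-].
rewrite setTI; have := mf k measurableT B mB; by rewrite setTI.
Qed.

Definition box (B : K -> set R) : set (Om R K) := [set w | forall k, B k (w k)].

Lemma measurable_box B : (forall k, measurable (B k)) -> measurable (box B).
Proof.
move=> mB.
have -> : box B = \big[setI/setT]_(k : K) ((fun w : Om R K => w k) @^-1` (B k)).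
  rewrite -bigcap_seq; apply/seteqP; split => w /=.
    by move=> h k _; exact: h.
  by move=> h k; apply: (h k) => /=; exact: mem_index_enum.
apply: bigsetI_measurable => k _.
by rewrite -[X in measurable X]setTI; exact: measurable_coord.
Qed.

(** Boxes are stable under intersection and generate the sigma-algebra, a coordinate cylinder being
    a box whose other sides are full; finiteness of [m1] lets the constant sequence [setT] serve as
    the exhausting sequence. *)
Lemma box_measure_unique (m1 m2 : {measure set (Om R K) -> \bar R}) :
  (m1 setT < +oo)%E ->
  (forall B, (forall k, measurable (B k)) -> m1 (box B) = m2 (box B)) ->
  forall A, measurable A -> m1 A = m2 A.
Proof.
move=> m1oo m12.
pose G : set (set (Om R K)) := [set A | exists B : K -> set R, (forall k, measurable (B k)) /\ A = box B].
have boxT : box (fun=> setT) = setT by apply/seteqP; split.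
apply: (measure_unique G (fun=> setT)) => //.
- apply/seteqP; split.
    apply: smallest_sub; first exact: smallest_sigma_algebra.
    move=> _ [k [B [mB ->]]]; apply: sub_sigma_algebra.
    exists (fun k' => if k' == k then B else setT); split.
      by move=> k'; case: ifP.
    apply/seteqP; split => w /=; last by move/(_ k); rewrite eqxx.
    by move=> Bw k'; case: ifP => // /eqP ->.
  apply: smallest_sub; first exact: sigma_algebra_measurable.
  by move=> _ [B [mB ->]]; exact: measurable_box.
- move=> _ _ [B [mB ->]] [C [mC ->]]; exists (fun k => B k `&` C k); split.
    by move=> k; exact: measurableI.
  apply/seteqP; split => w /=.
    by move=> [h1 h2] k; split.
  by move=> h; split => k; case: (h k).
- by move=> _; exists (fun=> setT); split => //.
- by rewrite bigcup_const//; exists 0.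
- by move=> A [B [mB ->]]; exact: m12.
Qed.

Definition upd (w : K -> R) (k : K) (x : R) : Om R K :=
  fun k' => if k' == k then x else w k'.

Lemma measurable_upd d (T : measurableType d) (f : T -> Om R K) (g : T -> R) k :
  measurable_fun setT f -> measurable_fun setT g ->
  measurable_fun setT (fun t => upd (f t) k (g t)).
Proof.
move=> mf mg; apply: measurable_to_Om => k'; rewrite /upd.
case: eqP => // _.
exact: (measurableT_comp (measurable_coord k') mf).
Qed.

(** Prescribing the values on boxes pins down the standard Gaussian law, by [box_measure_unique]. *)
Definition gauss_law (m : set (Om R K) -> \bar R) : Prop :=
  forall B, (forall k, measurable (B k)) ->
    m (box B) = (\prod_(k : K) normal_prob 0 1 (B k))%E.

End CoordinateSpace.

(** * Fubini in a single Gaussian coordinate *)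

Section Resample.
Variables (R : realType) (K : finType) (m : probability (Om R K) R).
Hypothesis mG : gauss_law m.
Local Open Scope ereal_scope.

Let rho (k : K) (z : measurableTypeR R * Om R K) : Om R K := upd z.2 k z.1.

Let mrho k : measurable_fun setT (rho k).
Proof.
apply: measurable_upd; [exact: measurable_snd|exact: measurable_fst].
Qed.

(** Redrawing coordinate [k] from an independent N(0,1) leaves the law unchanged, since the two
    measures agree on boxes. This replaces an iterated product over [K]: later Gaussian integrals
    are reduced to one dimension one coordinate at a time. *)
Lemma resample_measure (k : K) (A : set (Om R K)) : measurable A ->
  m A = pushforward (normal_prob 0 1 \x m) (rho k) A.
Proof.
pose m2 : {measure set (Om R K) -> \bar R} :=
  pushforward (normal_prob 0 1 \x m) (rho k : _ -> Om R K).
move=> mA; rewrite -/(m2 (mrho k) A).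
apply: box_measure_unique => //.
  by apply: (@le_lt_trans _ _ 1); [exact: probability_le1|exact: ltry].
move=> B mB; apply: (eq_trans (mG mB)); rewrite /= /pushforward.
have -> : rho k @^-1` box B = B k `*` box (fun k' => if k' == k then setT else B k').
  apply/seteqP; split => -[x w] /=; rewrite /box /rho /upd /=.
    move=> h; split; first by have := h k; rewrite eqxx.
    by move=> k'; have := h k'; case: eqP.
  by move=> [Bx h] k'; have := h k'; case: eqP => // ->.
have mB' k' : measurable (if k' == k then setT else B k') by case: ifP.
rewrite product_measure1E; [|exact: mB|exact: measurable_box].
rewrite [X in _ = _ * X](mG mB') (bigD1 k)//=; congr (_ * _).
rewrite [RHS](bigD1 k)//= eqxx [X in _ = X * _]probability_setT mul1e.
by apply: eq_bigr => i /negPf ->.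
Qed.

Lemma resample (k : K) (F : Om R K -> \bar R) :
  measurable_fun setT F -> (forall w, 0 <= F w) ->
  \int[m]_w F w = \int[m]_w \int[normal_prob 0 1]_x F (upd w k x).
Proof.
move=> mF F0.
transitivity (\int[pushforward (normal_prob 0 1 \x m) (rho k)]_w F w).
  by apply: eq_measure_integral => A mA _; exact: resample_measure.
rewrite ge0_integral_pushforward//=.
rewrite preimage_setT (fubini_tonelli2 (m1:=normal_prob 0 1) (m2:=m)) //.
exact: measurableT_comp.
Qed.

End Resample.

(** * One-dimensional normal law: density, translation, reflection, second moment *)

Section NormalDensity.
Variable R : realType.
Local Open Scope ereal_scope.
Local Notation leb := (@lebesgue_measure R).

Import HBNNSimple.

Let ge0_integral_normal_nnsfun (s : R) (f : {nnsfun R >-> R}) :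
  \int[normal_prob 0 s]_x (f x)%:E = \int[leb]_x ((f x)%:E * (normal_pdf 0 s x)%:E).
Proof.
have mpdf : measurable_fun setT (fun x : R => (normal_pdf 0 s x)%:E).
  by apply/measurable_EFinP; exact: measurable_normal_pdf.
have pdf0 x : 0 <= (normal_pdf 0 s x)%:E by rewrite lee_fin normal_pdf_ge0.
have mI r : measurable_fun setT (fun x => (r * \1_(f @^-1` [set r]) x)%:E).
  by apply/measurable_EFinP; apply: measurable_funM => //; exact: measurable_indic.
under [LHS]eq_integral do rewrite fimfunE -fsumEFin//.
rewrite [LHS]ge0_integral_fsum//; last first.
  by move=> n x _; rewrite EFinM nnfun_muleindic_ge0.
under [RHS]eq_integral.
  move=> x xD; rewrite fimfunE -fsumEFin// muleC ge0_mule_fsumr; last first.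
    by move=> r; rewrite EFinM nnfun_muleindic_ge0.
  over.
rewrite [RHS]ge0_integral_fsum//; last 2 first.
  - by move=> r; apply: emeasurable_funM; [exact: mpdf|exact: mI].
  - by move=> n x _; rewrite mule_ge0// EFinM nnfun_muleindic_ge0.
apply: eq_fsbigr => r _.
have [r0|r0] := leP 0%R r; last first.
  by rewrite preimage_nnfun0// !integral0_eq// => x _; rewrite indic0 mulr0 ?mule0.
have mfr : measurable (f @^-1` [set r]) by [].
have mI' : measurable_fun setT (fun x : R => (\1_(f @^-1` [set r]) x)%:E : \bar R).
  by apply/measurable_EFinP; exact: measurable_indic.
under [LHS]eq_integral do rewrite EFinM.
under [RHS]eq_integral do rewrite EFinM muleCA.
rewrite !ge0_integralZl//.
- rewrite integral_indic//.
  congr (_ * _); rewrite /= /normal_prob [X in integral _ X](@setIT R) [LHS]integral_mkcond.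
  apply: eq_integral => x _; rewrite patchE indicE.
  by case: ifP => _; rewrite ?mule1 ?mule0.
- exact: emeasurable_funM.
- by move=> x _; rewrite mule_ge0// lee_fin.
Qed.

(** Monotone convergence on both sides extends the simple-function case to all nonnegative
    measurable [f], infinite integrals included. *)
Lemma ge0_integral_normal_prob (s : R) (f : R -> \bar R) :
  measurable_fun setT f -> (forall x, 0 <= f x) ->
  \int[normal_prob 0 s]_x f x = \int[leb]_x (f x * (normal_pdf 0 s x)%:E).
Proof.
move=> mf f0; pose f_ := nnsfun_approx measurableT mf.
have mpdf : measurable_fun setT (fun x : R => (normal_pdf 0 s x)%:E).
  by apply/measurable_EFinP; exact: measurable_normal_pdf.
have pdf0 x : 0 <= (normal_pdf 0 s x)%:E by rewrite lee_fin normal_pdf_ge0.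
have mf_ n : measurable_fun setT (fun x : R => (f_ n x)%:E : \bar R).
  by apply/measurable_EFinP; exact: measurable_funPT.
have nd x a b : (a <= b)%N -> (f_ a x <= f_ b x)%R.
  by move=> ab; have /lefP := nd_nnsfun_approx measurableT mf ab; exact.
transitivity (lim (\int[normal_prob 0 s]_x (f_ n x)%:E @[n --> \oo])).
  rewrite -monotone_convergence//=.
  - apply: eq_integral => ? /[!inE] xD; apply/esym/cvg_lim => //=.
    exact: cvg_nnsfun_approx.
  - by move=> n ? _; rewrite lee_fin.
  - by move=> x _ a b ab; rewrite lee_fin; exact: nd.
under eq_fun do rewrite ge0_integral_normal_nnsfun.
rewrite -monotone_convergence//=.
- apply: eq_integral => x /[!inE] xD; apply/cvg_lim => //=.
  by apply: cvgeZr => //; exact: cvg_nnsfun_approx.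
- move=> n. by apply: emeasurable_funM; [exact: mf_|exact: mpdf].
- by move=> n ? _; rewrite mule_ge0// lee_fin.
- move=> x _ a b ab; apply: lee_wpmul2r => //.
  by rewrite lee_fin; exact: nd.
Qed.

(** Half-open intervals determine Lebesgue measure, and a translation preserves their lengths. *)
Lemma lebesgue_measure_shift (b : R) (A : set R) : measurable A ->
  pushforward leb (fun x : measurableTypeR R => (x + b)%R : measurableTypeR R) A = leb A.
Proof.
move=> mA; have mf : measurable_fun setT
   (fun x : measurableTypeR R => (x + b)%R : measurableTypeR R).
  exact: measurable_funD.
apply/esym.
pose m2 : {measure set (measurableTypeR R) -> \bar R} :=
  pushforward leb (fun x : measurableTypeR R => (x + b)%R : measurableTypeR R).
suff : leb A = m2 mf A by [].
apply: (lebesgue_measure_unique (mu := m2 mf)) => // _ [[a c]] _ <-.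
transitivity (leb `](a - b)%R, (c - b)%R]%classic); last first.
  congr (leb _); apply/seteqP; split => x /=; rewrite !in_itv /=.
    by rewrite ltrBlDr lerBrDr.
  by rewrite ltrBlDr lerBrDr.
rewrite !lebesgue_measure_itv/= !lte_fin ltrD2r.
by case: ifP => // _; rewrite -!EFinB; congr (_%:E); rewrite opprB addrA subrK.
Qed.

Lemma ge0_integral_shift (b : R) (f : R -> \bar R) :
  measurable_fun setT f -> (forall x, 0 <= f x) ->
  \int[leb]_x f (x + b)%R = \int[leb]_x f x.
Proof.
move=> mf f0.
have mS : measurable_fun setT
   (fun x : measurableTypeR R => (x + b)%R : measurableTypeR R).
  exact: measurable_funD.
transitivity (\int[pushforward leb
   (fun x : measurableTypeR R => (x + b)%R : measurableTypeR R)]_x f x).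
  by rewrite ge0_integral_pushforward//= preimage_setT.
by apply: eq_measure_integral => A mA _; exact: lebesgue_measure_shift.
Qed.

Lemma ge0_integral_oppr (f : R -> \bar R) :
  measurable_fun setT f -> (forall x, 0 <= f x) ->
  \int[leb]_x f (- x)%R = \int[leb]_x f x.
Proof.
move=> mf f0.
have mS : measurable_fun setT
   (fun x : measurableTypeR R => (- x)%R : measurableTypeR R).
  exact: oppr_measurable.
transitivity (\int[pushforward leb
   (fun x : measurableTypeR R => (- x)%R : measurableTypeR R)]_x f x).
  by rewrite ge0_integral_pushforward//= preimage_setT.
by apply: eq_measure_integral => A mA _; exact: lebesgue_measureN.
Qed.

Let pdfE (x : R) : (normal_pdf 0 1 x = normal_peak 1 * expR (- (x ^+ 2 / 2)))%R.
Proof.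
rewrite normal_pdfE ?oner_eq0// /normal_fun subr0 expr1n mulNr.
by rewrite -[(1 *+ 2)%R]/(2%:R)%R.
Qed.

(** The factor [e^(x^2 / 2)] cancels the normal density up to the constant [normal_peak 1], so both
    sides are the same multiple of a Lebesgue integral, which is translation invariant. *)
Lemma normal_prob_shift (b : R) (f : R -> \bar R) :
  measurable_fun setT f -> (forall x, 0 <= f x) ->
  \int[normal_prob 0 1]_x (f (x + b)%R * (expR (x ^+ 2 / 2))%:E) =
  \int[normal_prob 0 1]_x (f x * (expR (x ^+ 2 / 2))%:E).
Proof.
move=> mf f0.
have mexp : measurable_fun setT (fun x : R => (expR (x ^+ 2 / 2))%:E).
  apply/measurable_EFinP; apply: measurableT_comp => //.
  by apply: measurable_funM => //; exact: measurable_funX.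
have exp0 x : 0 <= (expR (x ^+ 2 / 2))%:E :> \bar R by rewrite lee_fin expR_ge0.
have mfb : measurable_fun setT (fun x : R => f (x + b)%R).
  by apply: (measurableT_comp mf); exact: measurable_funD.
have key g : measurable_fun setT g -> (forall x, 0 <= g x) ->
    \int[normal_prob 0 1]_x (g x * (expR (x ^+ 2 / 2))%:E) =
    (normal_peak 1)%:E * \int[leb]_x g x.
  move=> mg g0; rewrite ge0_integral_normal_prob.
  - rewrite -ge0_integralZl//; last by rewrite lee_fin normal_peak_ge0.
    apply: eq_integral => x _; rewrite -muleA -EFinM muleC; congr (_%:E * _).
    by rewrite pdfE mulrCA -expRD subrr expR0 mulr1.
  - exact: emeasurable_funM.
  - by move=> x; rewrite mule_ge0.
by rewrite !key// ge0_integral_shift.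
Qed.

Lemma normal_prob_oppr (f : R -> \bar R) :
  measurable_fun setT f -> (forall x, 0 <= f x) ->
  \int[normal_prob 0 1]_x f (- x)%R = \int[normal_prob 0 1]_x f x.
Proof.
move=> mf f0.
have mfN : measurable_fun setT (fun x : R => f (- x)%R).
  by apply: (measurableT_comp mf); exact: oppr_measurable.
rewrite !ge0_integral_normal_prob// -ge0_integral_oppr.
- apply: eq_integral => x _; congr (_ * _%:E).
    by rewrite opprK.
  by rewrite !pdfE sqrrN.
- apply: emeasurable_funM => //.
  by apply/measurable_EFinP; exact: measurable_normal_pdf.
- by move=> x; rewrite mule_ge0// lee_fin normal_pdf_ge0.
Qed.

(* [y <= e^y] at [y = x^2/4] compares the second moment with the total mass of N(0, 2). *)
Lemma normal_prob_sqr_le : \int[normal_prob 0 1]_x ((x ^+ 2)%:E : \bar R) <= 8%:E.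
Proof.
have msq : measurable_fun setT (fun x : R => (x ^+ 2)%:E).
  by apply/measurable_EFinP; exact: measurable_funX.
have sq0 (x : R) : 0 <= (x ^+ 2)%:E by rewrite lee_fin sqr_ge0.
rewrite ge0_integral_normal_prob//.
have mp s : measurable_fun setT (fun x : R => (normal_pdf 0 s x)%:E).
  by apply/measurable_EFinP; exact: measurable_normal_pdf.
pose s : R := Num.sqrt 2.
have s2 : (s ^+ 2 = 2)%R by rewrite sqr_sqrtr.
have s0 : s != 0%R by rewrite gt_eqF// sqrtr_gt0.
apply: (@le_trans _ _ (\int[leb]_x (8%:E * (normal_pdf 0 s x)%:E))).
  apply: ge0_le_integral => //.
  - by move=> x _; rewrite mule_ge0// lee_fin normal_pdf_ge0.
  - by apply: emeasurable_funM; [exact: msq|exact: mp].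
  - by apply: emeasurable_funM; [exact: measurable_cst|exact: mp].
  move=> x _; rewrite -!EFinM lee_fin pdfE normal_pdfE// /normal_fun subr0 s2.
  (* The ratio of the two peaks is [sqrt 2], rounded up to 2; together with the factor 4 of [h2]
     this gives 8. *)
  have h1 : (normal_peak 1 <= 2 * normal_peak s :> R)%R.
    rewrite /normal_peak s2 expr1n mul1r.
    have p0 : (0 < Num.sqrt (pi *+ 2) :> R)%R.
      by rewrite sqrtr_gt0 mulrn_wgt0// pi_gt0.
    have -> : ((2 * pi) *+ 2 = 2 * (pi *+ 2) :> R)%R by ring.
    rewrite sqrtrM// invfM mulrA; apply: ler_peMl; first by rewrite invr_ge0 ltW.
    rewrite -/s ler_pdivlMr ?mul1r; last by rewrite lt0r s0 sqrtr_ge0.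
    have := sqrtr_ge0 (2 : R); rewrite -/s => sge0; rewrite -s2; nra.
  have h2 : (x ^+ 2 * expR (- (x ^+ 2 / 2)) <= 4 * expR (- x ^+ 2 / (2 *+ 2)))%R.
    have -> : (- x ^+ 2 / (2 *+ 2) = - (x ^+ 2 / 2) + x ^+ 2 / 4 :> R)%R by field.
    rewrite expRD mulrCA [leLHS]mulrC ler_wpM2l ?expR_ge0//.
    have := expR_ge1Dx (x ^+ 2 / 4); lra.
  have := normal_peak_ge0 s; have := expR_ge0 (- x ^+ 2 / (2 *+ 2)).
  have := expR_ge0 (- (x ^+ 2 / 2)); have := normal_peak_ge0 (1 : R); have := sqr_ge0 x.
  move=> ? ? ? ? ?.
  apply: (@le_trans _ _ (normal_peak 1 * (4 * expR (- x ^+ 2 / (2 *+ 2)))))%R.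
    by rewrite mulrCA ler_wpM2l.
  rewrite mulrA mulrA ler_wpM2r//; lra.
rewrite ge0_integralZl//.
- by rewrite [X in _ * X]integral_normal_pdf mule1.
- exact: mp.
- by move=> x _; rewrite lee_fin normal_pdf_ge0.
Qed.
End NormalDensity.

(** * Gaussian vectors: invariance under shears, moments of linear forms *)

Section GaussianVector.
Variables (R : realType) (K : finType) (m : probability (Om R K) R).
Hypothesis mG : gauss_law m.
Local Open Scope ereal_scope.

Definition sqnorm (w : vec R K) : R := (\sum_(k : K) w k ^+ 2)%R.
Definition expG (w : vec R K) : \bar R := (expR (sqnorm w / 2))%:E.

Lemma measurable_sqnorm : measurable_fun [set: Om R K] sqnorm.
Proof.
apply: measurable_sum => k; apply: measurable_funX; exact: measurable_coord.
Qed.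

Lemma measurable_expG : measurable_fun [set: Om R K] expG.
Proof.
apply/measurable_EFinP; apply: measurableT_comp => //.
by apply: measurable_funM => //; exact: measurable_sqnorm.
Qed.

Lemma expG_ge0 w : 0 <= expG w. Proof. by rewrite lee_fin expR_ge0. Qed.

Lemma sqnorm_upd (w : vec R K) k x :
  (sqnorm (upd w k x) = x ^+ 2 + \sum_(k' | k' != k) w k' ^+ 2)%R.
Proof.
rewrite /sqnorm (bigD1 k)//= /upd eqxx; congr (_ + _)%R.
by apply: eq_bigr => i /negPf ->.
Qed.

Lemma upd_upd (w : vec R K) k x y : upd (upd w k x) k y = upd w k y.
Proof. by apply/funext => k'; rewrite /upd; case: eqP. Qed.

Lemma upd_same (w : vec R K) k x : upd w k x k = x.
Proof. by rewrite /upd eqxx. Qed.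

Lemma measurable_upd_section (w : vec R K) k :
  measurable_fun setT (fun x : R => upd w k x : Om R K).
Proof. apply: measurable_upd => //; exact: measurable_cst. Qed.

Lemma measurable_upd_self (k : K) (g : Om R K -> R) : measurable_fun setT g ->
  measurable_fun setT (fun w : Om R K => upd w k (g w) : Om R K).
Proof. by move=> mg; apply: measurable_upd => //; exact: measurable_id. Qed.

(** Once the other coordinates are frozen, [c] is a constant and the map is a translation of the
    line, so [resample] reduces the claim to [normal_prob_shift]. *)
Lemma integral_shear1 (k : K) (c : Om R K -> R) (F : Om R K -> \bar R) :
  measurable_fun setT c -> (forall w x, c (upd w k x) = c w) ->
  measurable_fun setT F -> (forall w, 0 <= F w) ->
  \int[m]_w (F (upd w k (w k + c w)%R) * expG w) = \int[m]_w (F w * expG w).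
Proof.
move=> mc ck mF F0.
have mu : measurable_fun setT (fun w : Om R K => upd w k (w k + c w)%R : Om R K).
  by apply: measurable_upd_self; apply: measurable_funD => //; exact: measurable_coord.
rewrite (resample mG k); last 2 first.
- apply: emeasurable_funM; last exact: measurable_expG.
  exact: measurableT_comp mF mu.
- by move=> w; rewrite mule_ge0// expG_ge0.
rewrite [RHS](resample mG k); last 2 first.
- by apply: emeasurable_funM => //; exact: measurable_expG.
- by move=> w; rewrite mule_ge0// expG_ge0.
apply: eq_integral => w _.
pose C : \bar R := (expR ((\sum_(k' | k' != k) w k' ^+ 2) / 2))%:E.
have eC x : expG (upd w k x) = C * (expR (x ^+ 2 / 2))%:E.
  by rewrite /expG sqnorm_upd mulrDl expRD EFinM muleC.
transitivity (\int[normal_prob 0 1]_x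
    ((F (upd w k (x + c w)%R) * C) * (expR (x ^+ 2 / 2))%:E)).
  by apply: eq_integral => x _; rewrite eC upd_same ck upd_upd muleA.
rewrite (normal_prob_shift (c w) (f := fun x => F (upd w k x) * C)).
- by apply: eq_integral => x _; rewrite eC muleA.
- apply: emeasurable_funM; last exact: measurable_cst.
  exact: (measurableT_comp mF (measurable_upd_section w k)).
- by move=> x; rewrite mule_ge0// lee_fin expR_ge0.
Qed.

Definition shear (D : seq K) (c : K -> Om R K -> R) (w : Om R K) : Om R K :=
  fun k => if k \in D then (w k + c k w)%R else w k.

Lemma measurable_shear D c : (forall k, measurable_fun setT (c k)) ->
  measurable_fun setT (shear D c).
Proof.
move=> mc; apply: measurable_to_Om => k; rewrite /shear; case: (k \in D).
  by apply: measurable_funD => //; exact: measurable_coord.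
exact: measurable_coord.
Qed.

(** Each [c k] sees only coordinates outside [P], which the shear fixes, so the simultaneous move is
    a composition of one-coordinate moves in any order. The induction runs over duplicate-free lists
    of elements of [P]. *)
Lemma integral_shear (P : pred K) (c : K -> Om R K -> R) (F : Om R K -> \bar R) :
  (forall k, measurable_fun setT (c k)) ->
  (forall k w w', (forall j, ~~ P j -> w j = w' j) -> c k w = c k w') ->
  measurable_fun setT F -> (forall w, 0 <= F w) ->
  \int[m]_w (F (shear (enum P) c w) * expG w) = \int[m]_w (F w * expG w).
Proof.
move=> mc cP mF F0.
have : {subset enum P <= P} by move=> k; rewrite mem_enum.
elim: (enum P) (enum_uniq P) => [|k s IH] /=.
  by move=> _ _; apply: eq_integral => w _; rewrite /shear.
move=> /andP[ks us] sP.
have Pk : P k by apply: sP; rewrite mem_head.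
have cupd j w x : c j (upd w k x) = c j w.
  by apply: cP => i Pi; rewrite /upd; case: eqP => // ik; move: Pi; rewrite ik Pk.
rewrite -IH//; last by move=> j js; apply: sP; rewrite in_cons js orbT.
rewrite -[RHS](@integral_shear1 k (c k))//.
- apply: eq_integral => w _; congr (F _ * _); apply/funext => j.
  rewrite /shear in_cons cupd; case: (eqVneq j k) => [->|jk] /=.
    by rewrite (negPf ks) upd_same.
  by rewrite /upd (negPf jk).
- by apply: (measurableT_comp mF); exact: measurable_shear.
Qed.

(** Reflection symmetry in one coordinate; it removes the cross terms in [integral_linear_sqr]. *)
Lemma integral_flip (k : K) (F : Om R K -> \bar R) :
  measurable_fun setT F -> (forall w, 0 <= F w) ->
  \int[m]_w F (upd w k (- w k)%R) = \int[m]_w F w.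
Proof.
move=> mF F0.
have mu : measurable_fun setT (fun w : Om R K => upd w k (- w k)%R : Om R K).
  apply: measurable_upd_self; apply: measurableT_comp => //; exact: measurable_coord.
rewrite (resample mG k)//; last exact: (measurableT_comp mF mu).
rewrite [RHS](resample mG k)//; apply: eq_integral => w _.
rewrite -(normal_prob_oppr (f := fun x => F (upd w k x)))//.
  by apply: eq_integral => x _; rewrite upd_same upd_upd.
exact: (measurableT_comp mF (measurable_upd_section w k)).
Qed.

(** The second moment of N(0,1), kept symbolic between the bounds 0 and 8. *)
Definition normal_m2 : R := fine (\int[normal_prob 0 1]_x ((x ^+ 2)%:E : \bar R)).

Lemma normal_m2E : \int[normal_prob 0 1]_x ((x ^+ 2)%:E : \bar R) = normal_m2%:E.
Proof.
rewrite /normal_m2 fineK// ge0_fin_numE.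
  exact: le_lt_trans (normal_prob_sqr_le R) (ltry _).
by apply: integral_ge0 => x _; rewrite lee_fin sqr_ge0.
Qed.

Lemma normal_m2_le : (normal_m2 <= 8)%R.
Proof. by rewrite -lee_fin -normal_m2E normal_prob_sqr_le. Qed.

Lemma normal_m2_ge0 : (0 <= normal_m2)%R.
Proof.
by rewrite fine_ge0// integral_ge0// => x _; rewrite lee_fin sqr_ge0.
Qed.

Lemma integral_coord_sqr k : \int[m]_w ((w k ^+ 2)%:E : \bar R) = normal_m2%:E.
Proof.
rewrite (resample mG k); last 2 first.
- by apply/measurable_EFinP; apply: measurable_funX; exact: measurable_coord.
- by move=> w; rewrite lee_fin sqr_ge0.
under eq_integral do under eq_integral do rewrite upd_same.
by rewrite normal_m2E integral_cst// [X in _ * X]probability_setT mule1.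
Qed.

(** Adding the integral to its image under the flip of coordinate [k] uses
    [(x + y)^2 + (- x + y)^2 = 2 x^2 + 2 y^2]: the cross term cancels pointwise, so all integrands
    stay nonnegative. *)
Lemma integral_linear_sqr (a : K -> R) (s : seq K) : uniq s ->
  \int[m]_w (((\sum_(k <- s) a k * w k) ^+ 2)%:E : \bar R) =
  (normal_m2 * \sum_(k <- s) a k ^+ 2)%:E.
Proof.
have mlin s' : measurable_fun [set: Om R K] (fun w : Om R K => (\sum_(k <- s') a k * w k)%R).
  by apply: measurable_sum => k; apply: measurable_funM => //; exact: measurable_coord.
elim: s => [_|k s IH /= /andP[ks us]].
  under eq_integral do rewrite big_nil expr0n.
  by rewrite integral0 big_nil mulr0.
under eq_integral do rewrite big_cons.
rewrite big_cons; set X := \int[m]_w _.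
pose S (w : Om R K) := (\sum_(k <- s) a k * w k)%R.
have Supd w x : S (upd w k x) = S w.
  apply: eq_big_seq => j js; rewrite /upd; case: eqP => // jk.
  by rewrite -jk js in ks.
have mk : measurable_fun setT (fun w : Om R K => a k * w k)%R.
  by apply: measurable_funM => //; exact: measurable_coord.
have mS : measurable_fun setT S by exact: mlin.
have XN : \int[m]_w (((- (a k * w k) + S w) ^+ 2)%:E : \bar R) = X.
  rewrite -[RHS](integral_flip k); last 2 first.
  - by apply/measurable_EFinP; apply: measurable_funX; exact: measurable_funD.
  - by move=> w; rewrite lee_fin sqr_ge0.
  by apply: eq_integral => w _; rewrite upd_same -/(S w) -/(S (upd _ _ _)) Supd mulrN.
have XX : X + X = (2 * (normal_m2 * (a k ^+ 2 + \sum_(j <- s) a j ^+ 2)))%:E.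
  rewrite -{2}XN -ge0_integralD//; last 4 first.
  - by move=> w _; rewrite lee_fin sqr_ge0.
  - by apply/measurable_EFinP; apply: measurable_funX; exact: measurable_funD.
  - by move=> w _; rewrite lee_fin sqr_ge0.
  - apply/measurable_EFinP; apply: measurable_funX; apply: measurable_funD => //.
    exact: measurableT_comp.
  transitivity (\int[m]_w ((2 * a k ^+ 2)%:E * (w k ^+ 2)%:E + 2%:E * (S w ^+ 2)%:E)).
    apply: eq_integral => w _; rewrite -!EFinM -!EFinD -/(S w); congr (_%:E); ring.
  have msq (f : Om R K -> R) : measurable_fun setT f ->
      measurable_fun setT (fun w => (f w ^+ 2)%:E).
    by move=> mf; apply/measurable_EFinP; exact: measurable_funX.
  rewrite ge0_integralD//; last 4 first.
  - by move=> w _; rewrite -EFinM lee_fin; apply: mulr_ge0; [nra|exact: sqr_ge0].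
  - apply: emeasurable_funM => //; apply: msq; exact: measurable_coord.
  - by move=> w _; rewrite -EFinM lee_fin mulr_ge0// sqr_ge0.
  - by apply: emeasurable_funM => //; exact: msq.
  rewrite !ge0_integralZl//; last 5 first.
  - exact: msq.
  - by move=> w _; rewrite lee_fin sqr_ge0.
  - by apply: msq; exact: measurable_coord.
  - by move=> w _; rewrite lee_fin sqr_ge0.
  - by rewrite lee_fin mulr_ge0// sqr_ge0.
  rewrite integral_coord_sqr IH// -!EFinM -EFinD; congr (_%:E); ring.
(* The finite value of [X + X] rules out an infinite [X]. *)
case: X XX {XN} => [x||]//= [] xx; congr (_%:E); lra.
Qed.

End GaussianVector.

(** * Frobenius norm and its inner product *)

Section Frobenius.
Variable R : realType.

Lemma frob2_tr (m k : nat) (A : 'M[R]_(m, k)) : frob2 A = \tr (A *m A^T).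
Proof.
rewrite /frob2 /mxtrace; apply: eq_bigr => i _; rewrite mxE.
by apply: eq_bigr => j _; rewrite mxE expr2.
Qed.

Lemma frob2_ge0 (m k : nat) (A : 'M[R]_(m, k)) : 0 <= frob2 A.
Proof. by apply: sumr_ge0 => i _; apply: sumr_ge0 => j _; exact: sqr_ge0. Qed.

Definition frobip (m k : nat) (A B : 'M[R]_(m, k)) : R := \tr (A *m B^T).

Lemma frobipC (m k : nat) (A B : 'M[R]_(m, k)) : frobip A B = frobip B A.
Proof. by rewrite /frobip -mxtrace_tr trmx_mul trmxK. Qed.

Lemma frob2D (m k : nat) (A B : 'M[R]_(m, k)) :
  frob2 (A + B) = frob2 A + 2 * frobip A B + frob2 B.
Proof.
rewrite !frob2_tr linearD /= mulmxDl !mulmxDr !linearD /=.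
rewrite -/(frobip A B) -/(frobip B A) (frobipC B A); ring.
Qed.

Lemma frob2Z (m k : nat) a (A : 'M[R]_(m, k)) : frob2 (a *: A) = a ^+ 2 * frob2 A.
Proof.
by rewrite !frob2_tr linearZ /= -scalemxAl -scalemxAr !linearZ /= mulrA expr2.
Qed.

Lemma frob2N (m k : nat) (A : 'M[R]_(m, k)) : frob2 (- A) = frob2 A.
Proof. by rewrite -scaleN1r frob2Z sqrrN expr1n mul1r. Qed.

Lemma frobipZl (m k : nat) a (A B : 'M[R]_(m, k)) : frobip (a *: A) B = a * frobip A B.
Proof. by rewrite /frobip -scalemxAl linearZ. Qed.

Lemma frobipZr (m k : nat) a (A B : 'M[R]_(m, k)) : frobip A (a *: B) = a * frobip A B.
Proof. by rewrite frobipC frobipZl frobipC. Qed.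

Lemma frobip_mulr (m k l : nat) (X : 'M[R]_(m, k)) (U : 'M[R]_(m, l)) (V : 'M[R]_(k, l)) :
  frobip X (U *m V^T) = frobip (X *m V) U.
Proof. by rewrite /frobip trmx_mul trmxK mulmxA. Qed.

Lemma frob2_frame (m k l : nat) (U : 'M[R]_(m, l)) (V : 'M[R]_(k, l)) :
  orth_frame V -> frob2 (U *m V^T) = frob2 U.
Proof.
by move=> oV; rewrite !frob2_tr trmx_mul trmxK -mulmxA (mulmxA V^T) oV mul1mx.
Qed.

Lemma frob2_trmx (m k : nat) (A : 'M[R]_(m, k)) : frob2 A^T = frob2 A.
Proof. by rewrite !frob2_tr trmxK mxtrace_mulC. Qed.

Lemma frob2_orth (k l : nat) (V : 'M[R]_(k, l)) : orth_frame V -> frob2 V = l%:R.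
Proof. by move=> oV; rewrite frob2_tr mxtrace_mulC oV mxtrace1. Qed.

(* Completing the square in [U]: the joint Gaussian exponent of [(U, X)] splits
   into that of [X] and that of [U] given [X]. *)
Lemma frob2_complete_square (n p r : nat) (lambda : R) (U : 'M[R]_(n, r))
    (X : 'M[R]_(n, p)) (V : 'M[R]_(p, r)) :
  0 <= lambda -> orth_frame V ->
  frob2 U + frob2 (X - Num.sqrt lambda *: (U *m V^T)) =
  frob2 X - lambda / (1 + lambda) * frob2 (X *m V)
  + (1 + lambda) * frob2 (U - (Num.sqrt lambda / (1 + lambda)) *: (X *m V)).
Proof.
move=> l0 oV; have : 1 + lambda != 0 by rewrite gt_eqF// ltr_pwDl.
have := sqr_sqrtr l0; set c := Num.sqrt lambda => c2 h.
rewrite -(scaleNr c) -(scaleNr (c / _)) !frob2D !frob2Z !frobipZr frobip_mulr.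
rewrite frob2_frame// (frobipC U) !sqrrN expr_div_n c2.
by field.
Qed.

End Frobenius.

Lemma preimage_smallest_measurable d (T : measurableType d) (S : Type)
    (G : set (set S)) (f : T -> S) :
  (forall A, G A -> measurable (f @^-1` A)) ->
  forall A, <<s G >> A -> measurable (f @^-1` A).
Proof.
move=> mG; apply: smallest_sub => //; split => /=.
- by rewrite preimage_set0.
- by move=> A mA; rewrite setTD -preimage_setC; exact: measurableC.
- by move=> A mA; rewrite preimage_bigcup; exact: bigcupT_measurable.
Qed.

Lemma sum_row (R : realType) (I J : finType) (i0 : I) (f : I * J -> R) :
  \sum_q (q.1 == i0)%:R * f q = \sum_j f (i0, j).
Proof.
rewrite (eq_bigr (fun q => (q.1 == i0)%:R * f (q.1, q.2))); last by case.
rewrite -(pair_bigA _ (fun i j => (i == i0)%:R * f (i, j))) (bigD1 i0)//= [X in _ + X]big1.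
  by rewrite addr0; apply: eq_bigr => j _; rewrite eqxx mul1r.
by move=> i /negPf ii; rewrite big1// => j _; rewrite ii mul0r.
Qed.

(** * The spiked model on Gaussian coordinates: change of frame and testing bound *)

Section SpikedGaussian.
Variables (R : realType) (n r p : nat).
Local Notation K := (('I_n * 'I_r) + ('I_n * 'I_p))%type.
Local Notation W := (Om R K).

Definition Ublock (w : vec R K) : 'M[R]_(n, r) := \matrix_(i, j) w (inl (i, j)).
Definition Zblock (w : vec R K) : 'M[R]_(n, p) := \matrix_(i, j) w (inr (i, j)).

Lemma sqnorm_blocks (w : vec R K) : sqnorm w = frob2 (Ublock w) + frob2 (Zblock w).
Proof.
rewrite /sqnorm big_sumType /frob2 !pair_bigA /=.
by congr (_ + _); apply: eq_bigr => -[i j] _; rewrite mxE.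
Qed.

Definition isZ (k : K) := if k is inr _ then true else false.
Definition isU (k : K) := if k is inl _ then true else false.

Definition shearZ (M : 'M[R]_(r, p)) : W -> W :=
  shear (enum isZ) (fun k w => if k is inr ij then (Ublock w *m M) ij.1 ij.2 else 0).

Definition shearU (M : 'M[R]_(p, r)) : W -> W :=
  shear (enum isU) (fun k w => if k is inl ij then (Zblock w *m M) ij.1 ij.2 else 0).

Lemma Ublock_shearZ M w : Ublock (shearZ M w) = Ublock w.
Proof. by apply/matrixP => i j; rewrite !mxE /shearZ /shear mem_enum. Qed.

Lemma Zblock_shearZ M w : Zblock (shearZ M w) = Zblock w + Ublock w *m M.
Proof. by apply/matrixP => i j; rewrite !mxE /shearZ /shear mem_enum /= !mxE. Qed.

Lemma Zblock_shearU M w : Zblock (shearU M w) = Zblock w.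
Proof. by apply/matrixP => i j; rewrite !mxE /shearU /shear mem_enum. Qed.

Lemma Ublock_shearU M w : Ublock (shearU M w) = Ublock w + Zblock w *m M.
Proof. by apply/matrixP => i j; rewrite !mxE /shearU /shear mem_enum /= !mxE. Qed.

Lemma measurable_Ublock i j : measurable_fun setT (fun w : W => Ublock w i j).
Proof.
rewrite (_ : (fun _ => _) = fun w : W => w (inl (i, j))); first exact: measurable_coord.
by apply/funext => w; rewrite mxE.
Qed.

Lemma measurable_Zblock i j : measurable_fun setT (fun w : W => Zblock w i j).
Proof.
rewrite (_ : (fun _ => _) = fun w : W => w (inr (i, j))); first exact: measurable_coord.
by apply/funext => w; rewrite mxE.
Qed.

Lemma measurable_mulmxl d (T : measurableType d) (a b c : nat)
    (f : T -> 'M[R]_(a, b)) (M : 'M[R]_(b, c)) :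
  (forall i j, measurable_fun setT (fun t => f t i j)) ->
  forall i j, measurable_fun setT (fun t => (f t *m M) i j).
Proof.
move=> mf i j.
rewrite (_ : (fun _ => _) = fun t => \sum_k f t i k * M k j); last first.
  by apply/funext => t; rewrite mxE.
by apply: measurable_sum => k; apply: measurable_funM.
Qed.

Let mcZ (M : 'M[R]_(r, p)) (k : K) : measurable_fun setT
  (fun w : W => (if k is inr ij then (Ublock w *m M) ij.1 ij.2 else 0) : R).
Proof.
case: k => [_|[i j]] /=; first exact: measurable_cst.
by apply: measurable_mulmxl; exact: measurable_Ublock.
Qed.

Let mcU (M : 'M[R]_(p, r)) (k : K) : measurable_fun setT
  (fun w : W => (if k is inl ij then (Zblock w *m M) ij.1 ij.2 else 0) : R).
Proof.
case: k => [[i j]|_] /=; last exact: measurable_cst.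
by apply: measurable_mulmxl; exact: measurable_Zblock.
Qed.

Lemma measurable_shearZ M : measurable_fun setT (shearZ M).
Proof. exact: measurable_shear. Qed.

Lemma measurable_shearU M : measurable_fun setT (shearU M).
Proof. exact: measurable_shear. Qed.

Variable m : probability W R.
Hypothesis mG : gauss_law m.

Local Notation I F := (\int[m]_w (F w * expG w))%E.

Lemma integral_shearZ M (F : W -> \bar R) : measurable_fun setT F ->
  (forall w, 0 <= F w)%E -> I (F \o shearZ M) = I F.
Proof.
move=> mF F0; apply: (integral_shear mG) => //.
move=> [_|[i j]] // w w' ww'; congr (fun A : 'M[R]_(_, _) => (A *m M) i j).
by apply/matrixP => a b; rewrite !mxE ww'.
Qed.

Lemma integral_shearU M (F : W -> \bar R) : measurable_fun setT F ->
  (forall w, 0 <= F w)%E -> I (F \o shearU M) = I F.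
Proof.
move=> mF F0; apply: (integral_shear mG) => //.
move=> [[i j]|_] // w w' ww'; congr (fun A : 'M[R]_(_, _) => (A *m M) i j).
by apply/matrixP => a b; rewrite !mxE ww'.
Qed.

Variable lambda : R.
Hypothesis lambda0 : 0 < lambda.
Let b := Num.sqrt lambda.

Definition Xblock (V : 'M[R]_(p, r)) (w : vec R K) : 'M[R]_(n, p) :=
  spiked (Ublock w) (Zblock w) V (fun=> lambda).

Lemma XblockE V w : Xblock V w = Zblock w + b *: (Ublock w *m V^T).
Proof.
rewrite /Xblock /spiked /Dmat addrC; congr (_ + _).
have -> : diag_mx (\row_(_ < r) Num.sqrt lambda) = b%:M.
  by apply/matrixP => i j; rewrite !mxE.
by rewrite mul_mx_scalar -scalemxAl.
Qed.

(** Read as [(U, Z) -> (U, X) -> (U', X) -> (U', Z')]. The first shear forms the observation under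
    [V]; the second replaces the conditional mean [sqrt lambda / (1 + lambda) X V] of [U] given [X]
    by its analogue for [V']; the third subtracts the signal of [V']. *)
Definition transport (V V' : 'M[R]_(p, r)) (w : W) : W :=
  shearZ (- (b *: V'^T)) (shearU ((b / (1 + lambda)) *: (V' - V)) (shearZ (b *: V^T) w)).

Lemma Xblock_transport V V' w : Xblock V' (transport V V' w) = Xblock V w.
Proof.
rewrite !XblockE /transport Zblock_shearZ Ublock_shearZ Zblock_shearU Zblock_shearZ.
by rewrite mulmxN -!scalemxAr subrK.
Qed.

(** Completing the square in both models, [X] and the deviation of [U] from its conditional mean are
    the same before and after, so only the terms [|X V|^2] and [|X V'|^2] differ. *)
Lemma sqnorm_transport V V' w : orth_frame V -> orth_frame V' ->
  sqnorm (transport V V' w) = sqnorm w -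
    lambda / (1 + lambda) * (frob2 (Xblock V w *m V') - frob2 (Xblock V w *m V)).
Proof.
move=> oV oV'; set X := Xblock V w; set w' := transport V V' w.
have l0 := ltW lambda0.
have hU : Ublock w' = Ublock w + (b / (1 + lambda)) *: (X *m (V' - V)).
  rewrite /w' /transport Ublock_shearZ Ublock_shearU Ublock_shearZ Zblock_shearZ.
  by rewrite -scalemxAr -[X in _ = _ + _ *: (X *m _)]/(Xblock V w) XblockE -!scalemxAr.
have Zw : Zblock w = X - b *: (Ublock w *m V^T) by rewrite /X XblockE addrK.
have Zw' : Zblock w' = X - b *: (Ublock w' *m V'^T).
  by rewrite /X -(Xblock_transport V V') XblockE addrK.
rewrite !sqnorm_blocks Zw Zw' !frob2_complete_square//.
have -> : Ublock w' - (b / (1 + lambda)) *: (X *m V') =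
          Ublock w - (b / (1 + lambda)) *: (X *m V).
  by rewrite hU mulmxBr scalerBr addrA addrAC addrK.
ring.
Qed.

Lemma measurable_Xblock V i j : measurable_fun setT (fun w : W => Xblock V w i j).
Proof.
rewrite (_ : (fun _ => _) = fun w : W => Zblock w i j + b * (Ublock w *m V^T) i j).
  apply: measurable_funD; first exact: measurable_Zblock.
  apply: measurable_funM => //; apply: measurable_mulmxl; exact: measurable_Ublock.
by apply/funext => w; rewrite XblockE !mxE.
Qed.

Lemma measurable_Xblock_preimage V (A : set 'M[R]_(n, p)) :
  <<s @mx_coord_sets R n p >> A -> measurable (Xblock V @^-1` A : set W).
Proof.
apply: preimage_smallest_measurable => _ [i [j [B [mB ->]]]].
have := measurable_Xblock V i j measurableT mB; rewrite setTI; exact.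
Qed.

Lemma integral_transport V V' (F : W -> \bar R) : measurable_fun setT F ->
  (forall w, 0 <= F w)%E -> I (F \o transport V V') = I F.
Proof.
move=> mF F0.
rewrite -(integral_shearZ (- (b *: V'^T)) mF F0).
have mF1 := measurableT_comp mF (measurable_shearZ (- (b *: V'^T))).
rewrite -(integral_shearU ((b / (1 + lambda)) *: (V' - V)) mF1); last by move=> w; exact: F0.
have mF2 := measurableT_comp mF1 (measurable_shearU ((b / (1 + lambda)) *: (V' - V))).
by rewrite -(integral_shearZ (b *: V^T) mF2) // => w; exact: F0.
Qed.

Local Open Scope ereal_scope.

(** The exponential is the likelihood ratio of [X] under [V'] against [V]; it has no normalising
    constant because the two covariances have equal determinants. Inserting
    [e^(-|w|^2 / 2) e^(|w|^2 / 2)] brings the integral to the form that [integral_transport]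
    preserves. *)
Lemma change_of_frame V V' (g : 'M[R]_(n, p) -> R) :
  orth_frame V -> orth_frame V' -> (forall X, 0 <= g X)%R ->
  (forall V, measurable_fun setT (fun w : W => g (Xblock V w))) ->
  \int[m]_w (g (Xblock V' w))%:E =
  \int[m]_w (g (Xblock V w) * expR (lambda / (1 + lambda) / 2 *
     (frob2 (Xblock V w *m V') - frob2 (Xblock V w *m V))))%:E.
Proof.
move=> oV oV' g0 mg.
pose F (w : W) : \bar R := (g (Xblock V' w) * expR (- (sqnorm w / 2)))%:E.
have mF : measurable_fun setT F.
  apply/measurable_EFinP; apply: measurable_funM => //.
  apply: measurableT_comp => //; apply: measurableT_comp => //.
  by apply: measurable_funM => //; exact: measurable_sqnorm.
transitivity (I F).
  apply: eq_integral => w _; rewrite /F /expG -EFinM -mulrA -expRD.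
  by rewrite addrC subrr expR0 mulr1.
rewrite -(integral_transport V V' mF); last first.
  by move=> w; rewrite lee_fin mulr_ge0// expR_ge0.
apply: eq_integral => w _.
rewrite /= /F /expG Xblock_transport -EFinM -[(g _ * _ * _)%R]mulrA -expRD sqnorm_transport//.
congr (_ * expR _)%:E; lra.
Qed.

(** Each entry of [X Q] is a linear form in the Gaussian coordinates, with coefficients [a i j], so
    its second moment comes from [integral_linear_sqr]. *)
Lemma integral_frob2_Xblock V (Q : 'M[R]_(p, r)) :
  \int[m]_w (frob2 (Xblock V w *m Q))%:E =
  (normal_m2 R * (n%:R * (frob2 Q + lambda * frob2 (V^T *m Q))))%:E.
Proof.
pose a (i : 'I_n) (j : 'I_r) (k : K) : R := (match k with
  | inl il => (il.1 == i)%:R * (b * (V^T *m Q) il.2 j)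
  | inr il => (il.1 == i)%:R * Q il.2 j end)%R.
have XQ w i j : ((Xblock V w *m Q) i j = \sum_k a i j k * w k)%R.
  rewrite XblockE mulmxDl -scalemxAl -mulmxA addrC mxE [X in (X + _)%R]mxE.
  rewrite [X in (b * X)%R]mxE [X in (_ + X)%R = _]mxE big_sumType /=.
  under [in RHS]eq_bigr do rewrite -mulrA.
  under [X in (_ = _ + X)%R]eq_bigr do rewrite -mulrA.
  rewrite !sum_row mulr_sumr; congr (_ + _)%R; apply: eq_bigr => l _ /=.
    by rewrite [Ublock _ _ _]mxE; ring.
  by rewrite mxE mulrC.
have aa i j : (\sum_k a i j k ^+ 2 =
    \sum_l lambda * (V^T *m Q) l j ^+ 2 + \sum_l Q l j ^+ 2)%R.
  rewrite big_sumType /=.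
  have sq (x : bool) (y : R) : ((x%:R * y) ^+ 2 = x%:R * y ^+ 2)%R.
    by case: x; rewrite ?mul1r ?mul0r ?expr0n.
  under eq_bigr do rewrite sq exprMn sqr_sqrtr ?ltW//.
  under [X in (_ + X)%R]eq_bigr do rewrite sq.
  by rewrite !sum_row.
have mXQ i j : measurable_fun setT (fun w : W => (((Xblock V w *m Q) i j) ^+ 2)%:E).
  apply/measurable_EFinP; apply: measurable_funX; apply: measurable_mulmxl.
  exact: measurable_Xblock.
rewrite /frob2; under eq_integral do rewrite -sumEFin.
rewrite ge0_integral_sum//; last 2 first.
- by move=> i; under eq_fun do rewrite -sumEFin; exact: emeasurable_sum.
- by move=> i w _; rewrite lee_fin sumr_ge0// => j _; exact: sqr_ge0.
transitivity (\sum_(i < n) \sum_(j < r) (normal_m2 R * \sum_k a i j k ^+ 2)%:E).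
  apply: eq_bigr => i _; under eq_integral do rewrite -sumEFin.
  rewrite ge0_integral_sum//; last by move=> j w _; rewrite lee_fin sqr_ge0.
  apply: eq_bigr => j _.
  under eq_integral do rewrite XQ.
  by rewrite (integral_linear_sqr mG)// index_enum_uniq.
rewrite (eq_bigr (fun=> (normal_m2 R * \sum_j (\sum_l lambda * (V^T *m Q) l j ^+ 2
    + \sum_l Q l j ^+ 2))%:E)%R); last first.
  by move=> i _; rewrite sumEFin -mulr_sumr; congr (_ * _)%:E; apply: eq_bigr.
rewrite sumEFin sumr_const card_ord; congr (_%:E); rewrite -[LHS]mulr_natl.
rewrite [LHS]mulrCA; congr (_ * (_ * _))%R.
rewrite big_split /= addrC; congr (_ + _)%R.
  by rewrite exchange_big.
by rewrite exchange_big mulr_sumr; apply: eq_bigr => l _; rewrite mulr_sumr.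
Qed.

Local Notation prob V A := (fine (m (Xblock V @^-1` A : set W))).

Lemma integral_indic_Xblock V (A : set 'M[R]_(n, p)) :
  <<s @mx_coord_sets R n p >> A ->
  \int[m]_w (\1_A (Xblock V w))%:E = (prob V A)%:E.
Proof.
move=> mA; have mXA := measurable_Xblock_preimage V mA.
transitivity (\int[m]_w (\1_(Xblock V @^-1` A : set W) w)%:E).
  by apply: eq_integral => w _; rewrite !indicE.
rewrite integral_indic// setIT fineK//; exact: fin_num_measure.
Qed.

(* With [ell] the log-likelihood ratio of the two laws of [X], integrate
   [1 + y <= e^y] at [y = t 1_A - ell]; both quadratic parts of [ell] are kept
   on the side where they are nonnegative. *)
Lemma frame_testing V V' (A : set 'M[R]_(n, p)) (t : R) :
  orth_frame V -> orth_frame V' -> <<s @mx_coord_sets R n p >> A -> (0 <= t)%R ->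
  (t * prob V A <= normal_m2 R / 2 * n%:R * hfun lambda * (r%:R - frob2 (V^T *m V'))
                   + (expR t - 1) * prob V' A)%R.
Proof.
move=> oV oV' mA t0.
pose d : R := (lambda / (1 + lambda) / 2)%R.
have d0 : (0 <= d)%R by rewrite !divr_ge0// ?addr_ge0// ltW.
have et1 : (0 <= expR t - 1)%R by rewrite subr_ge0 -expR0 ler_expR.
pose g (X : 'M[R]_(n, p)) : R := expR (t * \1_A X)%R.
have m1 V0 : measurable_fun setT (fun w : W => \1_A (Xblock V0 w) : R).
  rewrite (_ : (fun _ => _) = \1_(Xblock V0 @^-1` A : set W)).
    by apply: measurable_indic; exact: measurable_Xblock_preimage.
  by apply/funext => w; rewrite !indicE.
have mg V0 : measurable_fun setT (fun w : W => g (Xblock V0 w)).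
  by apply: measurableT_comp => //; exact: measurable_funM.
have mq V0 Q : measurable_fun setT (fun w : W => (frob2 (Xblock V0 w *m Q))).
  apply: measurable_sum => i; apply: measurable_sum => j; apply: measurable_funX.
  by apply: measurable_mulmxl; exact: measurable_Xblock.
pose q := (fun (V0 Q : 'M[R]_(p, r)) w => frob2 (Xblock V0 w *m Q)).
have int_const (x : R) : \int[m]_w x%:E = x%:E.
  by rewrite integral_cst// [X in _ * X]probability_setT mule1.
have int_affine V0 (x c : R) Q : (0 <= x)%R -> (0 <= c)%R ->
    \int[m]_w ((1 + x * \1_A (Xblock V0 w) + c * q V0 Q w)%:E) =
    (1 + x * prob V0 A + c * (normal_m2 R * (n%:R * (frob2 Q + lambda * frob2 (V0^T *m Q)))))%:E.
  move=> x0 c0.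
  have x10 w : (0 <= x * \1_A (Xblock V0 w))%R by rewrite mulr_ge0.
  under eq_integral do rewrite !EFinD.
  rewrite ge0_integralD//; last 4 first.
  - by move=> w _; rewrite -EFinD lee_fin addr_ge0.
  - apply/measurable_EFinP; apply: measurable_funD => //; exact: measurable_funM.
  - by move=> w _; rewrite lee_fin mulr_ge0// frob2_ge0.
  - by apply/measurable_EFinP; apply: measurable_funM => //; exact: mq.
  rewrite ge0_integralD//; last 2 first.
  - by move=> w _; rewrite lee_fin.
  - by apply/measurable_EFinP; exact: measurable_funM.
  under [X in _ + X + _]eq_integral do rewrite EFinM.
  under [X in _ + _ + X]eq_integral do rewrite EFinM.
  rewrite !ge0_integralZl//.
  all: try by apply/measurable_EFinP; first [exact: m1|exact: mq].
  all: try by move=> w _; rewrite lee_fin ?frob2_ge0.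
  by rewrite int_const integral_indic_Xblock// integral_frob2_Xblock -!EFinM -!EFinD.
(* As [\1_A] takes only the values 0 and 1, the exponential is affine in it; this is the origin of
   the factor [e^t - 1]. *)
have gE X : g X = (1 + (expR t - 1) * \1_A X)%R.
  rewrite /g indicE; case: (X \in A); rewrite ?mulr1 ?mulr0 ?expR0 ?addr0//; ring.
have := @change_of_frame V V' g oV oV' (fun X => expR_ge0 _) mg; set J := (X in _ = X) => EJ.
have J1 : J = (1 + (expR t - 1) * prob V' A)%:E.
  rewrite -EJ; under eq_integral do rewrite gE.
  have := int_affine V' (expR t - 1)%R 0%R V' et1 (lexx _); rewrite mul0r addr0 => <-.
  by apply: eq_integral => w _; rewrite mul0r addr0.
have : \int[m]_w ((1 + t * \1_A (Xblock V w) + d * q V V' w)%:E) <=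
       J + \int[m]_w ((d * q V V w)%:E).
  have mdq Q : measurable_fun setT (fun w : W => (d * q V Q w)%:E).
    by apply/measurable_EFinP; apply: measurable_funM => //; exact: mq.
  have mJ : measurable_fun setT (fun w : W =>
     (g (Xblock V w) * expR (d * (q V V' w - q V V w)))%:E).
    apply/measurable_EFinP; apply: measurable_funM => //.
    apply: measurableT_comp => //; apply: measurable_funM => //.
    by apply: measurable_funB; exact: mq.
  rewrite /J -ge0_integralD//; last 2 first.
  - by move=> w _; rewrite lee_fin mulr_ge0// expR_ge0.
  - by move=> w _; rewrite lee_fin mulr_ge0// frob2_ge0.
  apply: ge0_le_integral => //.
  - by move=> w _; rewrite lee_fin !addr_ge0// mulr_ge0// frob2_ge0.
  - apply/measurable_EFinP; apply: measurable_funD.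
      by apply: measurable_funD => //; exact: measurable_funM.
    by apply: measurable_funM => //; exact: mq.
  - by apply: emeasurable_funD.
  move=> w _; rewrite -EFinD lee_fin /g -expRD.
  have := expR_ge1Dx (t * \1_A (Xblock V w) + d * (q V V' w - q V V w)).
  rewrite /d /q; lra.
rewrite J1 int_affine//.
under eq_integral do rewrite EFinM.
rewrite ge0_integralZl//; last 2 first.
- by apply/measurable_EFinP; exact: mq.
- by move=> w _; rewrite lee_fin frob2_ge0.
rewrite integral_frob2_Xblock -EFinM -EFinD lee_fin.
(* Both frames have squared norm [r], so the difference of the two second moments keeps only the
   terms carrying [lambda]; with the factor [d] they combine into [hfun lambda]. *)
rewrite (frob2_orth oV) (frob2_orth oV') oV.
have -> : frob2 (1%:M : 'M[R]_r) = r%:R by rewrite frob2_tr trmx1 mulmx1 mxtrace1.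
have -> : hfun lambda = (2 * d * lambda)%R.
  rewrite /hfun /d; have : (lambda + 1 != 0)%R by rewrite gt_eqF// addr_gt0.
  rewrite addrC => ?; field; by [].
set x := prob V A; set y := prob V' A; set z := frob2 (V^T *m V').
lra.
Qed.

End SpikedGaussian.

(** The event splits over the finitely many truth tables [u] accepted by [Q]; each piece is a finite
    intersection of tests or their complements. *)
Lemma measurable_finite_table d (X : measurableType d) (J : finType)
    (t : X -> J -> bool) (Q : {ffun J -> bool} -> bool) :
  (forall j, measurable [set x | t x j]) ->
  measurable [set x | Q [ffun j => t x j]].
Proof.
move=> mt.
have -> : [set x | Q [ffun j => t x j]] =
    \bigcup_(u in [set u : {ffun J -> bool} | Q u])
    \bigcap_(j in [set: J]) (if u j then [set x | t x j] else ~` [set x | t x j]).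
  apply/seteqP; split => x /=.
    move=> Qx; exists [ffun j => t x j] => // j _; rewrite ffunE.
    by case: ifPn => // /negP.
  move=> [u Qu hu]; suff -> : [ffun j => t x j] = u by [].
  apply/ffunP => j; rewrite ffunE; have := hu j I.
  by case: ifPn => //= _ /negP/negbTE.
apply: fin_bigcup_measurable => [|u _]; first exact: finite_finset.
apply: fin_bigcap_measurable => [|j _]; first exact: finite_finset.
by case: ifP => _ //; exact: measurableC.
Qed.

(** * From an estimator to a minimum-distance decoder *)

Section Decoder.
Variables (R : realType) (n p r : nat).

Lemma frob2D_le (a b : nat) (A B : 'M[R]_(a, b)) :
  frob2 (A + B) <= 2 * frob2 A + 2 * frob2 B.
Proof.
have := frob2_ge0 (A - B); rewrite !frob2D frob2N.
by rewrite -[- B]scaleN1r frobipZr; lra.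
Qed.

Variables (Vhat : 'M[R]_(n, p) -> 'M[R]_(p, r)) (Theta : finType).
Variables (V : Theta -> 'M[R]_(p, r)) (theta0 : Theta).
Hypothesis mV : mx_borel_measurable Vhat.

Definition loss (X : 'M[R]_(n, p)) (theta : Theta) : R :=
  frob2 (Vhat X *m (Vhat X)^T - V theta *m (V theta)^T).

Definition first_of (u : {ffun Theta -> bool}) : Theta := odflt theta0 [pick theta | u theta].

(** Ties are broken by [pick]. Factoring through the truth table of the minimality tests makes
    measurability a case of [measurable_finite_table]. *)
Definition decoder (X : 'M[R]_(n, p)) : Theta :=
  first_of [ffun theta => [forall theta', loss X theta <= loss X theta']].

Lemma decoder_min X theta : loss X (decoder X) <= loss X theta.
Proof.
rewrite /decoder /first_of; case: pickP => /= [t|].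
  by rewrite ffunE => /forallP/(_ theta).
(* A minimiser over a finite set exists, so the default [theta0] of [first_of] is never the result
   of a failed search. *)
move/(_ [arg min_(t < theta0) loss X t]%O); rewrite ffunE => /negP[].
by case: arg_minP => // i _ h; apply/forallP => j; exact: h.
Qed.

(** The decoded projection is at least as close to the estimate as the one of [theta]; the squared
    triangle inequality through the estimate then costs 2 + 2. *)
Lemma decoder_loss X theta :
  frob2 (V (decoder X) *m (V (decoder X))^T - V theta *m (V theta)^T) <= 4 * loss X theta.
Proof.
have := decoder_min X theta; rewrite /loss; set A := _ *m _; set t' := decoder X => h.
have -> : V t' *m (V t')^T - V theta *m (V theta)^T =
  - (A - V t' *m (V t')^T) + (A - V theta *m (V theta)^T).
  by rewrite opprB addrA subrK.
by apply: le_trans (frob2D_le _ _) _; rewrite frob2N; lra.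
Qed.

Local Notation MX := (g_sigma_algebraType (@mx_coord_sets R n p)).

Lemma measurable_loss theta : measurable_fun setT (fun X : MX => loss X theta : R).
Proof.
have mVe i j : measurable_fun setT (fun X : MX => Vhat X i j : R).
  by move=> _ B mB; rewrite setTI; exact: mV.
apply: measurable_sum => i; apply: measurable_sum => j; apply: measurable_funX.
rewrite (_ : (fun _ => _) = fun X : MX =>
  \sum_k Vhat X i k * Vhat X j k - (V theta *m (V theta)^T) i j).
  apply: measurable_funB => //; apply: measurable_sum => k; exact: measurable_funM.
apply/funext => X; rewrite !mxE; congr (_ - _).
by apply: eq_bigr => k _; rewrite mxE.
Qed.

Lemma decoder_measurable (Q : Theta -> bool) :
  <<s @mx_coord_sets R n p >> [set X | Q (decoder X)].
Proof.
apply: (@measurable_finite_table _ MX _ _ (fun u => Q (first_of u))) => theta.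
have -> : [set X | [forall theta', loss X theta <= loss X theta']] =
   \bigcap_(theta' in [set: Theta]) [set X | loss X theta <= loss X theta'].
  apply/seteqP; split => X /=; first by move=> /forallP h t _; exact: h.
  by move=> h; apply/forallP => t; exact: h.
apply: fin_bigcap_measurable => [|t _]; first exact: finite_finset.
have := measurable_fun_ler (measurable_loss theta) (measurable_loss t).
move=> /(_ measurableT [set true] I); rewrite setTI.
suff -> : (fun X : MX => loss X theta <= loss X t) @^-1` [set true] =
  [set X | loss X theta <= loss X t] by [].
by apply/seteqP; split.
Qed.

End Decoder.

(** * Lower bound for a family indexed by words *)

Section ProductParameter.
Variables (R : realType) (n r p : nat).
Local Notation K := (('I_n * 'I_r) + ('I_n * 'I_p))%type.
Local Notation W := (Om R K).
Variables (m : probability W R) (mG : gauss_law m) (lambda : R) (lambda0 : 0 < lambda).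
Variables (B : finType) (M : nat).
Local Notation Theta := {ffun B -> 'I_M.+2}.

Definition set_block (theta : Theta) (b : B) (j : 'I_M.+2) : Theta :=
  [ffun b' => if b' == b then j else theta b'].

(** Exchanging letter [b] of a word with a spare letter; this bijection reindexes the double sum in
    [success_le]. *)
Lemma set_blockK (b : B) :
  involutive (fun q : Theta * 'I_M.+2 => (set_block q.1 b q.2, q.1 b)).
Proof.
move=> [theta j] /=; congr (_, _); last by rewrite ffunE eqxx.
by apply/ffunP => b'; rewrite !ffunE; case: eqP => // ->.
Qed.

Variables (V : Theta -> 'M[R]_(p, r)) (Vhat : 'M[R]_(n, p) -> 'M[R]_(p, r)) (sep D L : R).
Hypothesis oV : forall theta, orth_frame (V theta).
Hypothesis mVhat : mx_borel_measurable Vhat.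
Hypothesis sep0 : 0 <= sep.
Hypothesis Vsep : forall theta theta' : Theta, sep * (\sum_b (theta b != theta' b))%N%:R <=
  frob2 (V theta *m (V theta)^T - V theta' *m (V theta')^T).
Hypothesis Vclose : forall (theta : Theta) (b : B) (j : 'I_M.+2),
  r%:R - frob2 ((V theta)^T *m V (set_block theta b j)) <= D.
Hypothesis D0 : 0 <= D.
Hypothesis nhD : 80 * (n%:R * hfun lambda * D) <= ln M.+2%:R.

Let theta0 : Theta := [ffun=> ord0].
Let dec := decoder Vhat V theta0.
Let A (b : B) (j : 'I_M.+2) : set 'M[R]_(n, p) := [set X | dec X b == j].
Let mA b j : <<s @mx_coord_sets R n p >> (A b j).
Proof. exact: (decoder_measurable V theta0 mVhat (fun t => t b == j)). Qed.
Local Notation prob th A := (fine (m (Xblock lambda (V th) @^-1` A : set W))).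

Let hfun0 : 0 <= hfun lambda.
Proof. by rewrite /hfun divr_ge0 ?sqr_ge0// addr_ge0// ltW. Qed.

Let prob_sum th b : \sum_j prob th (A b j) = 1.
Proof.
suff : ((\sum_j prob th (A b j))%:E = 1%:E :> \bar R)%E by move=> [].
rewrite -sumEFin.
under eq_bigr do rewrite -(integral_indic_Xblock m lambda (V th) (mA b _)).
rewrite -ge0_integral_sum//; last first.
  move=> j; apply/measurable_EFinP.
  rewrite (_ : (fun _ => _) = \1_(Xblock lambda (V th) @^-1` (A b j) : set W)).
    by apply: measurable_indic; exact: measurable_Xblock_preimage.
  by apply/funext => w; rewrite !indicE.
transitivity (\int[m]_w (1%:E : \bar R))%E.
  apply: eq_integral => w _; rewrite sumEFin; congr (_%:E).
  rewrite (bigD1 (dec (Xblock lambda (V th) w) b))//= big1 ?addr0.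
    by rewrite indicE mem_set//= /A /= eqxx.
  move=> j jd; rewrite indicE memNset//= /A /= => /eqP jd'.
  by rewrite jd' eqxx in jd.
by rewrite integral_cst// [X in (_ * X)%E]probability_setT mule1.
Qed.

Let success b : R := \sum_th prob th (A b (th b)).

Let card0 : 0 < #|Theta|%:R :> R.
Proof. by rewrite ltr0n; apply/card_gt0P; exists theta0. Qed.

(* Averaging over the replaced block [j] as well makes the reference term a sum over
   all pairs, which the involution above turns into a sum of total masses. *)
Let success_le b : success b <= 7 / 8 * #|Theta|%:R.
Proof.
(* Here [e^t] is the square root of the alphabet size. After averaging, the success rate is at most
   [Q / t + (e^t - 1) / (e^(2 t) t)]; by [e^t - 1 <= t e^t] and [e^t >= 14/10] this is at most
   [1/10 + 10/14 < 7/8]. *)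
pose t : R := ln M.+2%:R / 2.
have M2 : (2 : R) <= M.+2%:R by rewrite ler_nat.
have eM : expR t ^+ 2 = M.+2%:R.
  by rewrite expr2 -expRD /t -mulrDl -[X in (X + X) / _]mulr1 -mulrDr mulfK// lnK// posrE; lra.
have e0 := expR_gt0 t.
have e14 : 14 / 10 <= expR t by nra.
have t0 : 0 < t.
  by rewrite -ltr_expR expR0; lra.
(* The 4 bounds [normal_m2 / 2], and the 80 in [nhD] is [2 * 4 * 10], which yields [10 Q <= t]. *)
pose Q : R := 4 * (n%:R * hfun lambda * D).
have Qt : 10 * Q <= t by rewrite /Q /t; move: nhD; set y := _ * D; set z := ln _; lra.
have test th j : t * prob th (A b (th b)) <=
    Q + (expR t - 1) * prob (set_block th b j) (A b (th b)).
  apply: le_trans (frame_testing mG lambda0 (oV _) (oV (set_block th b j)) (mA _ _) (ltW t0)) _.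
  rewrite lerD2r /Q.
  have h1 := Vclose th b j; have h2 := normal_m2_le R; have h3 := normal_m2_ge0 R.
  have h4 : 0 <= n%:R * hfun lambda :> R by rewrite mulr_ge0.
  apply: (@le_trans _ _ (normal_m2 R / 2 * n%:R * hfun lambda * D)).
    by apply: ler_wpM2l => //; rewrite -mulrA mulr_ge0// divr_ge0.
  have h5 : 0 <= n%:R * hfun lambda * D by rewrite mulr_ge0.
  have -> : normal_m2 R / 2 * n%:R * hfun lambda * D = normal_m2 R / 2 * (n%:R * hfun lambda * D).
    by rewrite !mulrA.
  by rewrite ler_wpM2r//; lra.
have : \sum_th \sum_(j < M.+2) t * prob th (A b (th b)) <=
   \sum_th \sum_(j < M.+2) (Q + (expR t - 1) * prob (set_block th b j) (A b (th b))).
  by apply: ler_sum => th _; apply: ler_sum => j _; exact: test.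
under eq_bigr do rewrite sumr_const card_ord -mulr_natl.
rewrite -mulr_sumr -mulr_sumr -/(success b).
under [leRHS]eq_bigr do rewrite big_split /= sumr_const card_ord -mulr_natl -mulr_sumr.
rewrite big_split /= sumr_const -mulr_sumr -mulr_natl.
have -> : \sum_th \sum_(j < M.+2) prob (set_block th b j) (A b (th b)) = #|Theta|%:R.
  rewrite (pair_bigA _ (fun th j => prob (set_block th b j) (A b (th b)))) /=.
  rewrite (reindex_inj (inv_inj (set_blockK b))) /=.
  transitivity (\sum_(th : Theta) \sum_(j < M.+2) prob th (A b j)).
    rewrite pair_bigA; apply: eq_bigr => -[th j] _ /=.
    have := set_blockK b (th, j) => /= -[-> ->].
    by [].
  by under eq_bigr do rewrite prob_sum; rewrite sumr_const.
have e1 : expR t - 1 <= expR t * t.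
  have := expR_ge1Dx (- t); rewrite expRN => h.
  have : expR t * (1 - t) <= expR t * (expR t)^-1 by rewrite ler_wpM2l// ltW.
  rewrite divff ?gt_eqF//; lra.
rewrite !mulr1 -[X in X + _]mulr_natl -eM.
clearbody t Q; move: (expR t) e0 e14 e1 => x x0 x14 x1 h.
have N0 := card0; set N : R := #|Theta|%:R in h N0 *.
have xt0 : 0 < x * x * t by rewrite !mulr_gt0.
rewrite -(ler_pM2l xt0).
have -> : x * x * t * success b = x ^+ 2 * (t * success b) by rewrite expr2 !mulrA.
apply: le_trans h _.
have -> : N * (x ^+ 2 * Q) + (x - 1) * N = N * (x ^+ 2 * Q + (x - 1)) by ring.
have -> : x * x * t * (7 / 8 * N) = N * (x * x * t * (7 / 8)) by ring.
rewrite ler_wpM2l ?ltW//.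
have h1 : x ^+ 2 * Q <= x * x * t / 10.
  have -> : x * x * t / 10 = x ^+ 2 * (t / 10) by rewrite expr2 !mulrA.
  by rewrite ler_wpM2l ?sqr_ge0//; lra.
have h2 : 0 <= x * t * (x - 14 / 10) by apply: mulr_ge0; [apply: mulr_ge0; exact: ltW|rewrite subr_ge0].
have h3 : 0 < x * t by rewrite mulr_gt0.
have h4 : x * t * x = x * x * t by rewrite mulrAC.
lra.
Qed.

Hypothesis risk_le : forall theta,
  (\int[m]_w (loss Vhat V (Xblock lambda (V theta) w) theta)%:E <= L%:E)%E.

(** By [decoder_loss] the loss is at least [sep / 4] times the number of wrongly decoded letters,
    and by [success_le] at least an eighth of the letters are wrong on average over words. Moving
    the correct letters to the right-hand side keeps every integrand nonnegative. *)
Lemma product_lower_bound : sep * #|B|%:R / 32 <= L.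
Proof.
have each th : sep / 4 * #|B|%:R <= L + sep / 4 * \sum_b prob th (A b (th b)).
  rewrite -lee_fin.
  have m1 b : measurable_fun setT (fun w : W => (\1_(A b (th b)) (Xblock lambda (V th) w))%:E : \bar R).
    apply/measurable_EFinP.
    rewrite (_ : (fun _ => _) = \1_(Xblock lambda (V th) @^-1` (A b (th b)) : set W)).
      by apply: measurable_indic; exact: measurable_Xblock_preimage.
    by apply/funext => w; rewrite !indicE.
  have mloss : measurable_fun setT
      (fun w : W => (loss Vhat V (Xblock lambda (V th) w) th)%:E : \bar R).
    apply/measurable_EFinP => _ Y mY; rewrite setTI.
    have := measurable_loss V mVhat th measurableT mY; rewrite setTI.
    exact: (measurable_Xblock_preimage lambda (V th)).
  apply: (@le_trans _ _ (\int[m]_w ((loss Vhat V (Xblock lambda (V th) w) th)%:E +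
     (sep / 4)%:E * \sum_b (\1_(A b (th b)) (Xblock lambda (V th) w))%:E))%E); last first.
    rewrite ge0_integralD//.
    - rewrite EFinD leeD//; rewrite ge0_integralZl//.
      + rewrite [leRHS]EFinM ge0_integral_sum// -sumEFin.
        by under eq_bigr do rewrite (integral_indic_Xblock m lambda (V th) (mA _ _)).
      + by apply: emeasurable_sum.
      + by move=> w _; apply: sume_ge0.
      + by rewrite lee_fin divr_ge0.
    - by move=> w _; rewrite lee_fin frob2_ge0.
    - by move=> w _; rewrite mule_ge0 ?lee_fin ?divr_ge0// sume_ge0.
    - by apply: emeasurable_funM => //; exact: emeasurable_sum.
  have -> : ((sep / 4 * #|B|%:R)%:E = \int[m]_w ((sep / 4 * #|B|%:R)%:E : \bar R))%E.
    by rewrite integral_cst// [X in (_ * X)%E]probability_setT mule1.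
  apply: ge0_le_integral => //.
  - by move=> w _; rewrite lee_fin mulr_ge0// divr_ge0.
  - apply: emeasurable_funD => //; apply: emeasurable_funM => //; exact: emeasurable_sum.
  move=> w _; rewrite sumEFin -EFinM -EFinD lee_fin.
  set X := Xblock _ _ _.
  have h1 := decoder_loss Vhat V theta0 X th.
  have h2 := Vsep (decoder Vhat V theta0 X) th.
  have h3 : #|B|%:R =  (\sum_b (dec X b != th b))%N%:R + \sum_b \1_(A b (th b)) X :> R.
    rewrite natr_sum -big_split /= -sumr_const; apply: eq_bigr => b _.
    rewrite indicE; have [db|db] := eqVneq (dec X b) (th b).
      by rewrite mem_set ?add0r// /A /=; apply/eqP.
    by rewrite memNset ?addr0// /A /=; exact/negP.
  rewrite h3 mulrDr; rewrite -/dec in h1 h2; lra.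
have : \sum_(th : Theta) sep / 4 * #|B|%:R <=
       \sum_(th : Theta) (L + sep / 4 * \sum_b prob th (A b (th b))).
  by apply: ler_sum => th _; exact: each.
have sum_cst (I : finType) (x : R) : \sum_(i : I) x = #|I|%:R * x.
  by rewrite sumr_const mulr_natl.
rewrite big_split !sum_cst -mulr_sumr exchange_big /= -/(success _).
have : \sum_b success b <= \sum_(b : B) 7 / 8 * #|Theta|%:R.
  by apply: ler_sum => b _; exact: success_le.
rewrite sum_cst.
have N0 := card0; set N := (#|Theta|%:R : R) in N0 *.
set b := (#|B|%:R : R); set S := \sum_(b0 : B) success b0 => h1 h2.
have h3 : sep / 4 * S <= sep / 4 * (b * (7 / 8 * N)) by rewrite ler_wpM2l// divr_ge0.
rewrite -(ler_pM2l N0).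
have -> : N * (sep * b / 32) = N * (sep / 4 * b) - sep / 4 * (b * (7 / 8 * N)) by field.
lra.
Qed.

End ProductParameter.

(** * Geometry of frames spanning graphs of small matrices *)

Section GraphFrame.
Variable R : realType.

(** Lagrange's identity: the defect is half the double sum of the squares
    [(a i * b j - a j * b i)^2]. *)
Lemma cauchy_schwarz_sum (I : finType) (a b : I -> R) :
  (\sum_i a i * b i) ^+ 2 <= (\sum_i a i ^+ 2) * (\sum_i b i ^+ 2).
Proof.
have : 0 <= \sum_i \sum_j (a i * b j - a j * b i) ^+ 2.
  by apply: sumr_ge0 => i _; apply: sumr_ge0 => j _; exact: sqr_ge0.
have -> : \sum_i \sum_j (a i * b j - a j * b i) ^+ 2 =
    \sum_i \sum_j (a i ^+ 2 * b j ^+ 2) + \sum_i \sum_j (a j ^+ 2 * b i ^+ 2)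
    - 2 * \sum_i \sum_j ((a i * b i) * (a j * b j)).
  rewrite -big_split mulr_sumr -sumrB; apply: eq_bigr => i _.
  rewrite -big_split mulr_sumr -sumrB; apply: eq_bigr => j _ /=; ring.
rewrite [X in _ + X - _]exchange_big /= -!big_distrlr /= -expr2; lra.
Qed.

Lemma frob2_mul (a b c : nat) (X : 'M[R]_(a, b)) (Y : 'M[R]_(b, c)) :
  frob2 (X *m Y) <= frob2 X * frob2 Y.
Proof.
rewrite {1 2}/frob2 mulr_suml; apply: ler_sum => i _.
rewrite -[frob2 Y]frob2_trmx /frob2 mulr_sumr; apply: ler_sum => j _.
rewrite mxE; apply: le_trans (cauchy_schwarz_sum _ _) _.
by under [X in _ <= _ * X]eq_bigr do rewrite mxE.
Qed.

Lemma frob2_col_mx (a b c : nat) (X : 'M[R]_(a, c)) (Y : 'M[R]_(b, c)) :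
  frob2 (col_mx X Y) = frob2 X + frob2 Y.
Proof.
rewrite /frob2 big_split_ord /=; congr (_ + _); apply: eq_bigr => i _; apply: eq_bigr => j _.
  by rewrite col_mxEu.
by rewrite col_mxEd.
Qed.

(* [V, C] is a thin QR factorisation of [A], and [B] inverts [C]. *)
Lemma gram_schmidt (p r : nat) (A : 'M[R]_(p, r)) :
  (forall x : 'cV[R]_r, A *m x = 0 -> x = 0) ->
  exists (V : 'M[R]_(p, r)) (B C : 'M[R]_r), [/\ orth_frame V, V = A *m B & A = V *m C].
Proof.
elim: r A => [|r IH] A injA.
  exists 0, 0, 0; split; last 2 first.
  - by rewrite mulmx0.
  - by rewrite mulmx0; apply/matrixP => i [].
  by apply/matrixP => -[].
have eA : A = row_mx (lsubmx (A : 'M[R]_(p, 1 + r))) (rsubmx (A : 'M[R]_(p, 1 + r))) by rewrite hsubmxK.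
move: eA; set a := lsubmx _; set A' := rsubmx _ => eA.
have a0 : 0 < frob2 a.
  rewrite lt_neqAle frob2_ge0 andbT eq_sym; apply/negP => /eqP fa.
  have az : a = 0.
    apply/matrixP => i j; rewrite [RHS]mxE.
    have sq0 k : 0 <= \sum_l a k l ^+ 2 by apply: sumr_ge0 => l _; exact: sqr_ge0.
    have h := psumr_eq0P (fun k _ => sq0 k) fa. 
    have /eqP : a i j ^+ 2 = 0 by apply: (psumr_eq0P _ (h i isT)) => // l _; exact: sqr_ge0.
    by rewrite sqrf_eq0 => /eqP.
  have Ae : A *m (col_mx 1%:M 0 : 'cV[R]_(1 + r)) = 0.
    by rewrite eA; apply: etrans (mul_row_col a A' _ _) _; rewrite az mul0mx mulmx0 addr0.
  have : usubmx (col_mx 1%:M 0 : 'cV[R]_(1 + r)) = usubmx (0 : 'cV[R]_(1 + r)).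
    exact: (congr1 (@usubmx R 1 r 1) (injA _ Ae)).
  rewrite col_mxKu => /matrixP /(_ ord0 ord0); rewrite !mxE eqxx => /eqP.
  by rewrite oner_eq0.
pose s := Num.sqrt (frob2 a).
have s0 : s != 0 by rewrite gt_eqF// sqrtr_gt0.
have s2 : s ^+ 2 = frob2 a by rewrite sqr_sqrtr// ltW.
pose u := s^-1 *: a.
have uu : u^T *m u = 1%:M.
  rewrite [u^T *m u]mx11_scalar -trace_mx11 mxtrace_mulC -frob2_tr frob2Z -s2.
  by rewrite exprVn mulVf// sqrf_eq0.
pose A2 := A' - u *m (u^T *m A').
have uA2 : u^T *m A2 = 0 by rewrite /A2 mulmxBr (mulmxA u^T u) uu mul1mx subrr.
(* A kernel vector of the projected columns [A2] extends to one of [A] by solving for its first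
   coordinate. *)
have [x A2x|V [B [C [oV VA AV]]]] := IH A2.
  have := injA (col_mx (- (s^-1 *: (u^T *m A' *m x))) x : 'cV[R]_(1 + r)).
  rewrite eA; have -> : row_mx a A' *m (col_mx (- (s^-1 *: (u^T *m A' *m x))) x : 'cV[R]_(1 + r)) =
     a *m - (s^-1 *: (u^T *m A' *m x)) + A' *m x by exact: mul_row_col.
  have -> : a *m - (s^-1 *: (u^T *m A' *m x)) + A' *m x = A2 *m x.
    rewrite mulmxN -scalemxAr scalemxAl -/u mulmxBl addrC.
    by rewrite !mulmxA.
  move=> /(_ A2x) h.
  have : dsubmx (col_mx (- (s^-1 *: (u^T *m A' *m x))) x : 'cV[R]_(1 + r)) =
         dsubmx (0 : 'cV[R]_(1 + r)) by exact: (congr1 (@dsubmx R 1 r 1) h).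
  by rewrite col_mxKd => ->; apply/matrixP => i j; rewrite !mxE.
have uV : u^T *m V = 0 by rewrite VA mulmxA uA2 mul0mx.
pose Vn : 'M[R]_(p, 1 + r) := row_mx u V.
pose Bn : 'M[R]_(1 + r) := block_mx (s^-1)%:M (- (s^-1 *: (u^T *m A' *m B))) 0 B.
pose Cn : 'M[R]_(1 + r) := block_mx s%:M (u^T *m A') 0 C.
have oVn : Vn^T *m Vn = 1%:M.
  rewrite tr_row_mx mul_col_row uu uV oV.
  have -> : V^T *m u = 0 by rewrite -[LHS]trmxK trmx_mul trmxK uV trmx0.
  by rewrite -scalar_mx_block.
have VBn : Vn = row_mx a A' *m Bn.
  rewrite mul_row_block !mulmx0 addr0 mul_mx_scalar -/u /Vn; congr (row_mx _ _).
  by rewrite VA mulmxN -scalemxAr scalemxAl -/u /A2 mulmxBl addrC !mulmxA.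
have ACn : row_mx a A' = Vn *m Cn.
  rewrite mul_row_block !mulmx0 addr0 mul_mx_scalar /u scalerA mulfV// scale1r.
  by congr (row_mx _ _); rewrite -/u -AV /A2 addrC subrK.
exists Vn, Bn, Cn; split.
- exact: oVn.
- by rewrite eA; exact: VBn.
- by rewrite eA; exact: ACn.
Qed.

Lemma frob2_complement (p r k : nat) (V : 'M[R]_(p, r)) (X : 'M[R]_(p, k)) :
  orth_frame V -> frob2 (X - V *m (V^T *m X)) = frob2 X - frob2 (V^T *m X).
Proof.
move=> oV; set Y := V^T *m X.
have h1 : frob2 (V *m Y) = frob2 Y.
  by rewrite -frob2_trmx trmx_mul frob2_frame// frob2_trmx.
have h2 : frobip X (V *m Y) = frob2 Y.
  by rewrite /frobip trmx_mul mulmxA mxtrace_mulC mulmxA -/Y frob2_tr.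
rewrite frob2D frob2N -[- (_ *m _)]scaleN1r frobipZr h1 h2; ring.
Qed.

Lemma frob2_sub_proj (p r : nat) (V V' : 'M[R]_(p, r)) : orth_frame V -> orth_frame V' ->
  frob2 (V *m V^T - V' *m V'^T) = 2 * (r%:R - frob2 (V^T *m V')).
Proof.
move=> oV oV'.
have h : frobip (V *m V^T) (V' *m V'^T) = frob2 (V^T *m V').
  by rewrite /frobip trmx_mul trmxK -mulmxA mxtrace_mulC frob2_tr trmx_mul trmxK !mulmxA.
rewrite frob2D frob2N !frob2_frame// (frob2_orth oV) (frob2_orth oV').
rewrite -[- (V' *m _)]scaleN1r frobipZr h; ring.
Qed.

(** The block row [[I, eps Q]] has squared operator norm at most 2; [graph_frame_sep] uses this
    twice. *)
Lemma frob2D_mul_le (a b c : nat) (eps : R) (P : 'M[R]_(a, c)) (Q : 'M[R]_(a, b))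
    (S : 'M[R]_(b, c)) : eps ^+ 2 * frob2 Q <= 1 ->
  frob2 (P + eps *: (Q *m S)) <= 2 * (frob2 P + frob2 S).
Proof.
move=> hQ; apply: le_trans (frob2D_le _ _) _; rewrite mulrDr lerD2l frob2Z ler_pM2l//.
apply: (@le_trans _ _ (eps ^+ 2 * (frob2 Q * frob2 S))).
  by rewrite ler_wpM2l ?sqr_ge0// frob2_mul.
by rewrite mulrA ler_piMl ?frob2_ge0.
Qed.

Variables (q r : nat) (eps : R).

Definition graph_mx (W : 'M[R]_(q, r)) : 'M[R]_(r + q, r) := col_mx 1%:M (eps *: W).

Lemma graph_mx_inj W (x : 'cV[R]_r) : graph_mx W *m x = 0 -> x = 0.
Proof.
rewrite mul_col_mx mul1mx => h; have := congr1 usubmx h.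
by rewrite col_mxKu => ->; apply/matrixP => i j; rewrite !mxE.
Qed.

Lemma graph_mxB W W' : frob2 (graph_mx W - graph_mx W') = eps ^+ 2 * frob2 (W - W').
Proof.
rewrite /graph_mx opp_col_mx add_col_mx subrr -scalerBr frob2_col_mx frob2Z.
suff -> : frob2 (0 : 'M[R]_r) = 0 by rewrite add0r.
by rewrite frob2_tr mul0mx mxtrace0.
Qed.

Definition graph_frame W (V : 'M[R]_(r + q, r)) :=
  exists B C : 'M[R]_r, [/\ orth_frame V, V = graph_mx W *m B & graph_mx W = V *m C].

Lemma graph_frame_exists W : exists V, graph_frame W V.
Proof.
have [V [B [C h]]] := gram_schmidt (@graph_mx_inj W).
by exists V, B, C.
Qed.

(** The left side is the squared distance from [V] to its projection on the range of [V']. That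
    residual equals the residual of [(A - A') B], with [A], [A'] the graph matrices, because [A']
    lies in the range of [V']; and multiplication by [B] is a contraction since
    [A^T A = I + eps^2 W^T W] dominates the identity. *)
Lemma graph_frame_close W W' V V' : graph_frame W V -> graph_frame W' V' ->
  r%:R - frob2 (V^T *m V') <= eps ^+ 2 * frob2 (W - W').
Proof.
move=> [B [C [oV VA AV]]] [B' [C' [oV' VA' AV']]].
have VTA : V^T *m graph_mx W = C by rewrite AV mulmxA oV mul1mx.
have CB : C *m B = 1%:M by rewrite -VTA -mulmxA -VA oV.
have BC := mulmx1C CB.
have contr (D : 'M[R]_(r + q, r)) : frob2 (D *m B) <= frob2 D.
  (* As [B B^T] inverts [A^T A], the inner product of [D] and [Y] equals both [|D B|^2] and
     [|A Y^T|^2], the latter at least [|Y|^2]; expanding [|D - Y|^2 >= 0] gives the contraction. *)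
  pose Y := D *m B *m B^T; set A := graph_mx W in VA AV VTA *.
  have DY : D = Y *m (A^T *m A).
    rewrite /Y -!mulmxA (mulmxA B^T) -trmx_mul -VA VTA BC mulmx1 //.
  have h1 : frobip D Y = frob2 (D *m B).
    by rewrite /frobip /Y frob2_tr !trmx_mul trmxK !mulmxA.
  have h2 : frobip Y D = frob2 (A *m Y^T).
    by rewrite DY -frob2_trmx /frobip frob2_tr !trmx_mul !trmxK !mulmxA.
  have h3 : frob2 Y <= frob2 (A *m Y^T).
    rewrite /A mul_col_mx mul1mx frob2_col_mx frob2_trmx lerDl; exact: frob2_ge0.
  have := frob2_ge0 (D - Y); rewrite frob2D frob2N -[- Y]scaleN1r frobipZr.
  move: h2; rewrite frobipC h1 => h2; lra.
have -> : r%:R - frob2 (V^T *m V') = frob2 (V - V' *m (V'^T *m V)).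
  by rewrite frob2_complement// (frob2_orth oV) -(frob2_trmx (V^T *m V')) trmx_mul trmxK.
have -> : V - V' *m (V'^T *m V) =
  (graph_mx W - graph_mx W') *m B - V' *m (V'^T *m ((graph_mx W - graph_mx W') *m B)).
  rewrite mulmxBl -VA !mulmxBr AV' -(mulmxA V') (mulmxA V'^T V') oV' mul1mx.
  by rewrite opprB addrA subrK.
rewrite frob2_complement// -graph_mxB.
by apply: le_trans (contr _); rewrite gerBl frob2_ge0.
Qed.

(** The matrix [N = [- eps W', I]] kills the range of [V'] and sends the graph matrix of [W] to
    [eps (W - W')]. Hence [eps (W - W') = N Y C] with [Y] the residual of [V] off the range of [V'];
    [N] and [C] each cost a factor 2, and the projections are at squared distance [2 |Y|^2]. *)
Lemma graph_frame_sep W W' V V' : graph_frame W V -> graph_frame W' V' ->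
  eps ^+ 2 * frob2 W <= 1 -> eps ^+ 2 * frob2 W' <= 1 ->
  eps ^+ 2 / 2 * frob2 (W - W') <= frob2 (V *m V^T - V' *m V'^T).
Proof.
move=> [B [C [oV VA AV]]] [B' [C' [oV' VA' AV']]] hW hW'.
pose N : 'M[R]_(q, r + q) := row_mx (- (eps *: W')) 1%:M.
pose Y := V - V' *m (V'^T *m V).
have NV' : N *m V' = 0.
  by rewrite VA' mulmxA /N /graph_mx mul_row_col mulmx1 mul1mx addNr mul0mx.
have NYC : N *m (Y *m C) = eps *: (W - W').
  rewrite mulmxA /Y mulmxBr (mulmxA N V') NV' mul0mx subr0 -mulmxA -AV.
  by rewrite /N /graph_mx mul_row_col mulmx1 mul1mx addrC scalerBr.
have NY (X : 'M[R]_(r + q, r)) : frob2 (N *m X) <= 2 * frob2 X.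
  rewrite -(vsubmxK X) mul_row_col mul1mx mulNmx -scalemxAl -scalerN -mulmxN addrC.
  by apply: le_trans (frob2D_mul_le _ _ hW') _; rewrite frob2N frob2_col_mx addrC.
have YC (X : 'M[R]_(r + q, r)) : frob2 (X *m C) <= 2 * frob2 X.
  have -> : C = V^T *m graph_mx W by rewrite AV mulmxA oV mul1mx.
  rewrite mulmxA -frob2_trmx trmx_mul /graph_mx tr_col_mx trmx1 linearZ /=.
  rewrite -[X in _ <= 2 * X](frob2_frame X oV) -[X in _ <= 2 * X]frob2_trmx.
  rewrite -(vsubmxK (X *m V^T)^T) mul_row_col mul1mx -scalemxAl frob2_col_mx.
  by apply: frob2D_mul_le; rewrite frob2_trmx.
have YE : frob2 (V *m V^T - V' *m V'^T) = 2 * frob2 Y.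
  rewrite frob2_sub_proj// /Y frob2_complement// (frob2_orth oV).
  by rewrite -(frob2_trmx (V^T *m V')) trmx_mul trmxK.
have := NY (Y *m C); have := YC Y; rewrite NYC frob2Z YE; lra.
Qed.

Lemma graph_frame_nnz W V : graph_frame W V -> (nnz_rows V <= r + nnz_rows W)%N.
Proof.
move=> [B [C [_ -> _]]]; rewrite /nnz_rows.
apply: (@leq_trans #|(@lshift r q) @: 'I_r :|: (@rshift r q) @: [set i | row i W != 0]|).
  apply: subset_leq_card; apply/fintype.subsetP => i; rewrite !inE => hi.
  case: (splitP i) => j ij.
    apply/orP; left; apply/imsetP; exists j; [by []|exact: val_inj].
  apply/orP; right; apply/imsetP; exists j; last by apply: val_inj.
  rewrite inE /=; apply: contra hi => /eqP Wj.
  have -> : i = rshift r j by apply: val_inj.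
  by rewrite row_mul /graph_mx rowKd linearZ /= Wj scaler0 mul0mx.
apply: leq_trans (leq_card_setU _ _) _; apply: leq_add.
  by apply: leq_trans (leq_imset_card _ _) _; rewrite card_ord.
exact: leq_imset_card.
Qed.

End GraphFrame.

(** * Passing from the given probability space to coordinate space *)

Section Transfer.
Variables (R : realType) (d : measure_display) (T : measurableType d) (P : probability T R).
Variables (n p r : nat) (U : T -> 'M[R]_(n, r)) (Z : T -> 'M[R]_(n, p)).
Hypothesis UZ : gauss_entries P U Z.
Local Notation K := (('I_n * 'I_r) + ('I_n * 'I_p))%type.

Let entries (t : T) : Om R K :=
  fun k => match k with inl ij => U t ij.1 ij.2 | inr ij => Z t ij.1 ij.2 end.

(** The law [m] is the push-forward of [P] under the vector of all entries. The one-point family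
    indexed by [tt] lets the risk at a single frame be written with [loss]. *)
Lemma gauss_entries_law : exists m : probability (Om R K) R, gauss_law m /\
  forall lambda (Vhat : 'M[R]_(n, p) -> 'M[R]_(p, r)) V, mx_borel_measurable Vhat ->
    risk P U Z Vhat V (fun=> lambda) =
    (\int[m]_w (loss Vhat (fun=> V) (Xblock lambda V w) tt)%:E)%E.
Proof.
have [mk lawk] := UZ.
have me : measurable_fun setT entries.
  by apply: measurable_to_Om => -[ij|ij]; [exact: (mk (inl ij))|exact: (mk (inr ij))].
pose X : {mfun T >-> Om R K} := HB.pack entries (isMeasurableFun.Build _ _ _ _ entries me).
exists (distribution P X); split.
  move=> B mB; rewrite -(lawk B mB) /distribution /pushforward; congr (P _).
  apply/seteqP; split => t /=.
    by move=> h [ij|ij] _ /=; exact: h.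
  by move=> h [ij|ij]; [exact: (h (inl ij) I)|exact: (h (inr ij) I)].
move=> lambda Vhat V mV.
rewrite ge0_integral_distribution; last 2 first.
- apply/measurable_EFinP => _ Y mY; rewrite setTI.
  have := measurable_loss (fun=> V) mV tt measurableT mY; rewrite setTI.
  exact: (measurable_Xblock_preimage lambda V).
- by move=> w; rewrite lee_fin frob2_ge0.
rewrite /risk; apply: eq_integral => t _ /=; rewrite /loss /Xblock.
have -> : Ublock (entries t) = U t by apply/matrixP => i j; rewrite mxE.
by have -> : Zblock (entries t) = Z t by apply/matrixP => i j; rewrite mxE.
Qed.

End Transfer.

(** * One-hot encoding of words by matrices *)

Section OneHot.
Variables (R : realType) (q r M : nat) (B : finType).
Variable pos : B * 'I_M.+1 -> 'I_q * 'I_r.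
Hypothesis pos_inj : injective pos.
Local Notation Theta := {ffun B -> 'I_M.+2}.

Definition place (v : B * 'I_M.+1 -> R) : 'M[R]_(q, r) :=
  \matrix_(i, l) \sum_c (pos c == (i, l))%:R * v c.

Lemma placeB v v' : place v - place v' = place (fun c => v c - v' c).
Proof.
apply/matrixP => i l; rewrite !mxE -sumrB.
by apply: eq_bigr => c _; rewrite mulrBr.
Qed.

Lemma frob2_place v : frob2 (place v) = \sum_c v c ^+ 2.
Proof.
have sq x : (\sum_c (pos c == x)%:R * v c) ^+ 2 = \sum_c (pos c == x)%:R * v c ^+ 2.
  case: (pickP (fun c => pos c == x)) => [c0 /eqP <-|h].
    have off (f : B * 'I_M.+1 -> R) : \sum_c (pos c == pos c0)%:R * f c = f c0.
      rewrite (bigD1 c0)//= eqxx mul1r big1 ?addr0// => c cc0.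
      by rewrite (inj_eq pos_inj) (negPf cc0) mul0r.
    by rewrite !off.
  by rewrite !big1 ?expr0n// => c _; rewrite h mul0r.
rewrite /frob2 pair_bigA /=.
transitivity (\sum_x \sum_c (pos c == x)%:R * v c ^+ 2).
  by apply: eq_bigr => -[i l] _; rewrite mxE sq.
rewrite exchange_big; apply: eq_bigr => c _ /=.
by rewrite (bigD1 (pos c))//= eqxx mul1r big1 ?addr0// => x; rewrite eq_sym => /negPf ->; rewrite mul0r.
Qed.

(** The letter [ord0] leaves its block empty and [lift ord0 j] switches on slot [j], so [M + 1]
    slots carry [M + 2] letters. *)
Definition letter (theta : Theta) (c : B * 'I_M.+1) : R := (theta c.1 == lift ord0 c.2)%:R.

Definition onehot_mx (theta : Theta) : 'M[R]_(q, r) := place (letter theta).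

Lemma sum_letter (x : 'I_M.+2) : \sum_(j < M.+1) (x == lift ord0 j)%:R = (x != ord0)%:R :> R.
Proof.
case: (unliftP ord0 x) => [j ->|->].
  rewrite (bigD1 j)//= eqxx big1 ?addr0 1?eq_sym ?neq_lift//.
  by move=> i ij; rewrite (inj_eq lift_inj) eq_sym (negPf ij).
by rewrite big1// => j _; rewrite (negPf (neq_lift _ _)).
Qed.

(** Distinct letters differ in one slot if one of them is [ord0], and in two slots otherwise. *)
Lemma letter_dist (x y : 'I_M.+2) :
  (x != y)%:R <=
    (\sum_(j < M.+1) ((x == lift ord0 j)%:R - (y == lift ord0 j)%:R) ^+ 2 : R) <=
  2 * (x != y)%:R.
Proof.
have [<-|xy] /= := eqVneq x y.
  by rewrite big1 ?mulr0 ?lexx// => j _; rewrite subrr expr0n.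
have sqB (a b : bool) : (a%:R - b%:R) ^+ 2 <= a%:R + b%:R :> R by case: a; case: b => /=; lra.
apply/andP; split; last first.
  apply: le_trans (ler_sum _ (fun j _ => sqB _ _)) _.
  by rewrite big_split /= !sum_letter; case: eqP; case: eqP => /=; lra.
case: (unliftP ord0 x) xy => [j ->|->] xy.
  rewrite (bigD1 j)//= eqxx eq_sym (negPf xy) subr0 expr1n lerDl.
  by apply: sumr_ge0 => i _; exact: sqr_ge0.
case: (unliftP ord0 y) xy => [j ->|->] xy; last by rewrite eqxx in xy.
rewrite (bigD1 j)//= eqxx ?(negPf (neq_lift _ _)) sub0r sqrrN expr1n lerDl.
by apply: sumr_ge0 => i _; exact: sqr_ge0.
Qed.

Lemma onehot_dist (theta theta' : Theta) :
  (\sum_b (theta b != theta' b))%N%:R <= frob2 (onehot_mx theta - onehot_mx theta')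
  <= 2 * (\sum_b (theta b != theta' b))%N%:R.
Proof.
rewrite /onehot_mx placeB frob2_place natr_sum mulr_sumr.
rewrite -(pair_bigA _ (fun b j => (letter theta (b, j) - letter theta' (b, j)) ^+ 2)) /=.
by apply/andP; split; apply: ler_sum => b _; have /andP[] := letter_dist (theta b) (theta' b).
Qed.

Lemma onehot_norm (theta : Theta) : frob2 (onehot_mx theta) <= #|B|%:R.
Proof.
rewrite frob2_place -(pair_bigA _ (fun b j => letter theta (b, j) ^+ 2)) /=.
rewrite -sumr_const; apply: ler_sum => b _.
rewrite (eq_bigr (fun j => (theta b == lift ord0 j)%:R)); last first.
  by move=> j _; rewrite /letter /=; case: eqP; rewrite ?expr1n ?expr0n.
by rewrite sum_letter; case: eqP.
Qed.

(** The set [D] is left free because the dense layout takes all slots, while the block layout takes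
    only the active ones. *)
Lemma onehot_nnz (theta : Theta) (D : {pred B * 'I_M.+1}) :
  (forall c, theta c.1 == lift ord0 c.2 -> c \in D) ->
  (nnz_rows (onehot_mx theta) <= #|[seq (pos c).1 | c in D]|)%N.
Proof.
move=> hD; apply: subset_leq_card; apply/fintype.subsetP => i; rewrite inE /=.
apply: contraTT => hi; rewrite negbK; apply/eqP/matrixP => i0 l; rewrite !mxE.
rewrite big1// => c _; case: eqP => [pc|]; last by rewrite mul0r.
rewrite /letter; case: (boolP (theta c.1 == lift ord0 c.2)) => [h|]; last by rewrite mulr0.
by case/negP: hi; apply/fintype.imageP; exists c; rewrite ?hD// pc.
Qed.

End OneHot.

(** * Lower bound for a given placement of the slots *)

Section BlockBound.
Variables (R : realType) (d : measure_display) (T : measurableType d) (P : probability T R).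
Variables (n q r s M : nat) (B : finType) (kappa lambda : R).
Variables (U : T -> 'M[R]_(n, r)) (Z : T -> 'M[R]_(n, r + q)).
Hypotheses (UZ : gauss_entries P U Z) (n0 : (0 < n)%N) (lambda0 : 0 < lambda).
Hypothesis kappa1 : 1 < kappa.
Variable pos : B * 'I_M.+1 -> 'I_q * 'I_r.
Hypothesis pos_inj : injective pos.
Hypothesis pos_rows : forall theta : {ffun B -> 'I_M.+2},
  (r + nnz_rows (onehot_mx R pos theta) <= s)%N.

Lemma block_lower_bound (Vhat : 'M[R]_(n, r + q) -> 'M[R]_(r + q, r)) : estimator Vhat ->
  ((Num.min (#|B|%:R * ln M.+2%:R / (n%:R * hfun lambda)) 1 / 160 / 64)%:E <=
   ereal_sup [set x | exists (V : 'M[R]_(r + q, r)) (lam : 'I_r -> R),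
      Theta0 kappa s lambda V lam /\ x = risk P U Z Vhat V lam])%E.
Proof.
move=> [mVhat _]; set S := ereal_sup _.
have [m [mG riskE]] := gauss_entries_law UZ.
have nh0 : 0 < n%:R * hfun lambda :> R.
  by rewrite mulr_gt0 ?ltr0n// /hfun divr_gt0 ?exprn_gt0// addr_gt0.
have lnM0 : 0 <= ln M.+2%:R :> R by rewrite ln_ge0// ler1n.
(* The first term ensures [nhD] for [D = 2 e2], whence [160 = 80 * 2]; the second ensures
   [eps^2 |W|^2 <= 1]. For empty [B] the inverse of 0 is 0 and [e2] vanishes. *)
pose e2 : R := Num.min (ln M.+2%:R / (160 * (n%:R * hfun lambda))) (#|B|%:R)^-1.
have e20 : 0 <= e2.
  by rewrite le_min invr_ge0 ler0n andbT divr_ge0// mulr_ge0// ltW.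
pose eps := Num.sqrt e2.
have epsE : eps ^+ 2 = e2 by rewrite sqr_sqrtr.
pose W := @onehot_mx R q r M B pos.
have /choice[V hV] : forall theta, exists V, graph_frame eps (W theta) V.
  by move=> theta; exact: graph_frame_exists.
have oV theta : orth_frame (V theta) by case: (hV theta) => ? [? []].
have small theta : eps ^+ 2 * frob2 (W theta) <= 1.
  rewrite epsE; apply: (@le_trans _ _ (e2 * #|B|%:R)).
    by rewrite ler_wpM2l// onehot_norm.
  apply: (@le_trans _ _ ((#|B|%:R)^-1 * #|B|%:R)).
    by rewrite ler_wpM2r// ge_min lexx orbT.
  by have [->|b0] := eqVneq (#|B|%:R : R) 0; rewrite ?mulr0// mulVf.
have VS theta : (risk P U Z Vhat (V theta) (fun=> lambda) <= S)%E.
  apply: ereal_sup_ubound; exists (V theta), (fun=> lambda); split => //; split => //.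
  - by apply: leq_trans (graph_frame_nnz (hV theta)) _; exact: pos_rows.
  - by move=> i; split => //; rewrite ler_peMl// ltW.
have riskL theta : (\int[m]_w (loss Vhat V (Xblock lambda (V theta) w) theta)%:E <= S)%E.
  by apply: le_trans (VS theta); rewrite riskE.
have S0 : (0 <= S)%E.
  apply: le_trans (riskL [ffun=> ord0]).
  by apply: integral_ge0 => w _; rewrite lee_fin frob2_ge0.
case: S S0 {VS} riskL => [L _ riskL|_ _|//]; last exact: leey.
(* The separation [e2 / 2] is the one of [graph_frame_sep]; changing one letter moves [W] by at most
   2 in squared norm, so [graph_frame_close] gives [2 * e2]. *)
have := @product_lower_bound R n r (r + q) m mG lambda lambda0 B M V Vhat (e2 / 2) (2 * e2) L
  oV mVhat.
have e22 : 0 <= e2 / 2 by rewrite divr_ge0.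
move=> /(_ e22) plb.
have {}plb : e2 / 2 * #|B|%:R / 32 <= L.
  apply: plb => //.
  - move=> theta theta'.
    have := graph_frame_sep (hV theta) (hV theta') (small _) (small _); rewrite epsE.
    apply: le_trans; rewrite ler_wpM2l//.
    by have /andP[] := onehot_dist R pos_inj theta theta'.
  - move=> theta b j; apply: le_trans (graph_frame_close (hV theta) (hV _)) _.
    rewrite epsE mulrC ler_wpM2r//.
    have /andP[_ h] := onehot_dist R pos_inj theta (set_block theta b j).
    apply: le_trans h _; rewrite ler_piMr// lern1.
    rewrite (bigD1 b)//= big1 ?addn0 ?leq_b1// => b' /negPf bb'.
    by rewrite ffunE bb' eqxx.
  - by rewrite mulr_ge0.
  - have : e2 <= ln M.+2%:R / (160 * (n%:R * hfun lambda)) by rewrite ge_min lexx.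
    rewrite ler_pdivlMr; last by rewrite mulr_gt0.
    by move: (n%:R * hfun lambda) (ln _) => y z; lra.
rewrite lee_fin; apply: le_trans plb.
have h : Num.min (#|B|%:R * ln M.+2%:R / (n%:R * hfun lambda)) 1 <= 160 * (e2 * #|B|%:R).
  rewrite /e2; set y := n%:R * hfun lambda in nh0 *; set z := ln _ in lnM0 *.
  have [->|b0] := eqVneq (#|B|%:R : R) 0.
    by rewrite !mul0r !mulr0 ge_min lexx.
  case: (leP (z / (160 * y)) (#|B|%:R)^-1) => _.
    rewrite ge_min; apply/orP; left; rewrite le_eqVlt; apply/orP; left; apply/eqP.
    by field; rewrite gt_eqF.
  rewrite mulVf// ge_min; apply/orP; right; lra.
move: h; set x := Num.min _ _; lra.
Qed.

End BlockBound.

(** * The dense and the block layouts *)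

Section Positions.
Variables (R : realType) (q r k : nat).

(** The binary case [M = 0]: every entry of the first [k] rows is a block of its own. *)
Definition dense_pos (kq : (k <= q)%N) (c : ('I_k * 'I_r) * 'I_1) : 'I_q * 'I_r :=
  (widen_ord kq c.1.1, c.1.2).

Lemma dense_pos_inj kq : injective (dense_pos kq).
Proof.
move=> [[i l] j] [[i' l'] j'] [] ii' ->; rewrite (ord1 j) (ord1 j').
by congr (_, _, _); apply: val_inj.
Qed.

Lemma dense_pos_nnz kq (theta : {ffun 'I_k * 'I_r -> 'I_2}) :
  (nnz_rows (onehot_mx R (dense_pos kq) theta) <= k)%N.
Proof.
apply: leq_trans (@onehot_nnz _ _ _ _ _ _ _ predT _) _ => //.
apply: (@leq_trans #|codom (widen_ord kq)|).
  apply: subset_leq_card; apply/fintype.subsetP => i /fintype.imageP[c _ ->].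
  exact: codom_f.
by apply: leq_trans (leq_image_card _ _) _; rewrite card_ord.
Qed.

Variable M : nat.
Hypothesis (Mk : (k * M.+1 <= q)%N) (r0 : (0 < r)%N).

Lemma block_pos_subproof (c : 'I_k * 'I_M.+1) : (c.1 * M.+1 + c.2 < q)%N.
Proof.
apply: leq_trans Mk; apply: (@leq_trans (c.1 * M.+1 + M.+1)).
  by rewrite ltn_add2l.
by rewrite -mulSnr leq_mul2r ltn_ord orbT.
Qed.

(** All slots lie in the first column, block [b] filling [M + 1] consecutive rows; each block then
    contributes at most one nonzero row. *)
Definition block_pos (c : 'I_k * 'I_M.+1) : 'I_q * 'I_r :=
  (Ordinal (block_pos_subproof c), Ordinal r0).

Lemma block_pos_inj : injective block_pos.
Proof.
move=> [b j] [b' j'] [] /= h.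
have /val_inj hb : b = b' :> nat.
  by have := congr1 (divn^~ M.+1) h; rewrite /= !divnMDl// !divn_small// !addn0.
by move: h; rewrite hb => /addnI /val_inj ->.
Qed.

Lemma block_pos_nnz (theta : {ffun 'I_k -> 'I_M.+2}) :
  (nnz_rows (onehot_mx R block_pos theta) <= k)%N.
Proof.
pose D := [pred c : 'I_k * 'I_M.+1 | theta c.1 == lift ord0 c.2].
apply: leq_trans (@onehot_nnz _ _ _ _ _ _ _ D _) _ => //.
apply: leq_trans (leq_image_card _ _) _.
have inj : {in D &, injective (fun c : 'I_k * 'I_M.+1 => c.1)}.
  move=> [b j] [b' j']; rewrite !inE /= => /eqP hj /eqP hj' bb'.
  by move: hj'; rewrite -bb' hj => /lift_inj ->.
rewrite -(card_in_image inj); apply: leq_trans (max_card _) _.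
by rewrite card_ord.
Qed.

End Positions.

(** From [e^(-1/2) >= 1 - 1/2] one gets [e^(1/2) <= 2]. *)
Lemma ln2_ge_half (R : realType) : 1 / 2 <= ln 2 :> R.
Proof.
have e0 : 0 < expR (1 / 2) :> R := expR_gt0 _.
have : expR (1 / 2) <= 2 :> R.
  have h := expR_ge1Dx (- (1 / 2) : R); rewrite expRN in h.
  have : expR (1 / 2) * (1 - 1 / 2) <= expR (1 / 2) * (expR (1 / 2))^-1 :> R.
    by rewrite ler_wpM2l// ltW.
  rewrite divff ?gt_eqF//; lra.
move=> h; rewrite -[leLHS]expRK ler_ln ?posrE//.
Qed.

(** * Combination of the two layouts into the minimax rate *)

Theorem theorem3 (R : realType) :
  exists c : R, 0 < c /\
  forall (kappa : R), 1 < kappa ->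
  forall (n p s r : nat) (lambda : R),
    (0 < n)%N -> (1 <= r)%N -> (r <= s)%N -> (s <= p)%N -> 0 < lambda ->
  forall (d : measure_display) (T : measurableType d) (P : probability T R)
         (U : T -> 'M[R]_(n, r)) (Z : T -> 'M[R]_(n, p)),
    gauss_entries P U Z ->
    ((c * rate n p s r lambda)%:E <= minimax_risk kappa s lambda P U Z)%E.
Proof.
(* The factors 160 and 64 come from [block_lower_bound]; 5 is [2 + 3], the weights of the dense and
   block bounds in the final comparison. *)
exists (160^-1 / 64 / 5); split; first by rewrite !divr_gt0 ?invr_gt0.
move=> kappa kappa1 n p s r lambda n0 r1 rs sp lambda0.
have [q pE] : exists q, p = (r + q)%N by exists (p - r)%N; rewrite subnKC// (leq_trans rs).
have [k sE] : exists k, s = (r + k)%N by exists (s - r)%N; rewrite subnKC.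
subst p s => {rs} d T P U Z UZ.
have kq : (k <= q)%N by rewrite leq_add2l in sp.
apply: le_ereal_inf_tmp => _ [Vhat estV <-].
set S := ereal_sup _.
have nh0 : 0 < n%:R * hfun lambda :> R.
  by rewrite mulr_gt0 ?ltr0n// /hfun divr_gt0 ?exprn_gt0// addr_gt0.
have dense : ((Num.min ((k * r)%:R * ln 2 / (n%:R * hfun lambda)) 1 / 160 / 64)%:E <= S)%E.
  have := block_lower_bound (s := (r + k)%N) UZ n0 lambda0 kappa1 (dense_pos_inj (kq := kq)) _ estV.
  rewrite card_prod !card_ord; apply => theta.
  by rewrite leq_add2l dense_pos_nnz.
rewrite /rate /sparse_term !addKn.
(* For [s = r] the rate is 0, and the dense bound reduces to the nonnegativity of [S]. *)
have [k0|k0] := posnP k.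
  rewrite k0 addn0 eqxx muln0 addr0 mul0r minEle ler01 mulr0.
  apply: le_trans dense; rewrite lee_fin k0 mul0n !mul0r minEle ler01 mul0r.
  by [].
have -> : (r + k == r)%N = false by rewrite -[X in _ == X]addn0 eqn_add2l gtn_eqF.
have q0 : (0 < q %/ k)%N by rewrite divn_gt0.
pose M := (q %/ k).-1.
have M1 : M.+1 = (q %/ k)%N by rewrite /M prednK.
have Mk : (k * M.+1 <= q)%N by rewrite M1 mulnC leq_divM.
have block : ((Num.min (k%:R * ln M.+2%:R / (n%:R * hfun lambda)) 1 / 160 / 64)%:E <= S)%E.
  have := block_lower_bound (s := (r + k)%N) UZ n0 lambda0 kappa1 (block_pos_inj (Mk := Mk) (r0 := r1)) _ estV.
  rewrite card_ord; apply => theta.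
  by rewrite leq_add2l block_pos_nnz.
(* The floor gives [q / k <= M + 2], and the summand [ln e = 1] is at most
   [2 ln 2 <= 2 ln (M + 2)]. *)
have log_le : ln (expR 1 * q%:R / k%:R) <= 3 * ln M.+2%:R :> R.
  have kR : 0 < k%:R :> R by rewrite ltr0n.
  have qR : 0 < q%:R :> R by rewrite ltr0n (leq_trans k0).
  have h1 : q%:R / k%:R <= M.+2%:R :> R.
    by rewrite ler_pdivrMr// -natrM ler_nat M1 ltnW// ltn_ceil.
  rewrite -mulrA lnM ?posrE ?expR_gt0 ?divr_gt0// expRK.
  have h2 : ln (q%:R / k%:R) <= ln M.+2%:R :> R by rewrite ler_ln ?posrE ?divr_gt0// ltr0n.
  have h3 : ln 2 <= ln M.+2%:R :> R by rewrite ler_ln ?posrE ?ler_nat.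
  have := ln2_ge_half R; lra.
move: dense block; case: S => [L||] //; last by move=> _ _; exact: leey.
rewrite !lee_fin => dense block.
set y := n%:R * hfun lambda in nh0 dense block *.
set a := (k * r)%:R * ln 2 / y in dense; set b := k%:R * _ / y in block.
have hT : ((r * k)%:R + k%:R * ln (expR 1 * q%:R / k%:R)) / y <= 2 * a + 3 * b.
  have -> : 2 * a + 3 * b = (2 * ((k * r)%:R * ln 2) + 3 * (k%:R * ln M.+2%:R)) / y.
    by rewrite /a /b [RHS]mulrDl !mulrA.
  rewrite ler_pM2r ?invr_gt0// lerD//.
    rewrite mulnC mulrCA ler_peMr//; have := ln2_ge_half R; lra.
  by rewrite mulrCA ler_wpM2l.
have a0 : 0 <= a by rewrite divr_ge0 ?(ltW nh0)// mulr_ge0// ln_ge0// ler1n.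
have b0 : 0 <= b by rewrite divr_ge0 ?(ltW nh0)// mulr_ge0// ln_ge0// ler1n.
(* If [a] or [b] exceeds 1, the right side is already at least 2; otherwise this is [hT]. *)
have : Num.min (((r * k)%:R + k%:R * ln (expR 1 * q%:R / k%:R)) / y) 1 <=
       2 * Num.min a 1 + 3 * Num.min b 1.
  rewrite ge_min; case: (leP a 1) => ha; case: (leP b 1) => hb; apply/orP;
    [left|right|right|right]; lra.
move: dense block; set ma := Num.min a 1; set mb := Num.min b 1; set mt := Num.min _ 1.
lra.
Qed.
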